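(* Let $\mathcal{R}$ be an expansion of $(\mathbb{R},<,+)$ that does not define a dense $\omega$-orderable set. Let $A \subseteq \mathbb{R}^n$ be $D_\Sigma$. Then the following are equivalent: - $A$ does not have interior (i.e. its interior is empty), - $A$ is nowhere dense, - $A$ has $n$-dimensional Lebesgue measure zero.
   Context: ''Definable'' means first-order definable in $\mathcal{R}$, with parameters allowed. A definable subset of $\mathbb{R}^n$ is $\omega$-orderable if it is either finite or admits a definable ordering with order type $\omega$. $\mathcal{R}$ defines a dense $\omega$-orderable set if it defines an $\omega$-orderable subset of $\mathbb{R}$ that is dense in some nonempty open interval. A set $A \subseteq \mathbb{R}^n$ is $D_\Sigma$ if there is a definable family $\{X_{r,s} : r,s > 0\}$ ($r,s$ real; i.e. $\{(r,s,x) : r,s>0,\ x \in X_{r,s}\}$ is definable) such that for all $r,r',s,s' > 0$: (i) $X_{r,s}$ is a compact subset of $\mathbb{R}^n$; (ii) $X_{r,s} \subseteq X_{r',s'}$ if $r \le r'$ and $s \ge s'$; (iii) $A = \bigcup_{r,s} X_{r,s}$. *)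

(* Defs.v *)
From HB Require Import structures.
From mathcomp Require Import all_boot all_order all_algebra.
From mathcomp Require Import all_classical all_reals all_analysis.
Set Implicit Arguments.
Unset Strict Implicit.
Unset Printing Implicit Defensive.
Import Order.TTheory GRing.Theory Num.Theory.
Import numFieldNormedType.Exports.
Local Open Scope classical_set_scope.
Local Open Scope ring_scope.

(* An expansion of (R, <, +): only the extra function and relation symbols are
   listed, [<] and [+] being part of the syntax below.  Constants are function
   symbols of arity 0; the sets of symbols are arbitrary. *)
Record expansion (R : realType) := Expansion {
  fsym : Type;
  farity : fsym -> nat;
  fint : forall f : fsym, ('I_(farity f) -> R) -> R;
  rsym : Type;
  rarity : rsym -> nat;
  rint : forall r : rsym, ('I_(rarity r) -> R) -> Prop }.

Section FirstOrder.
Context {R : realType}.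
Variable M : expansion R.

Inductive term :=
| Var of nat
| Plus of term & term
| App (f : fsym M) of ('I_(farity f) -> term).

(* Variables are de Bruijn indices: [Ex] binds index 0. *)
Inductive formula :=
| Eq of term & term
| Lt of term & term
| Rel (r : rsym M) of ('I_(rarity r) -> term)
| Neg of formula
| And of formula & formula
| Ex of formula.

Fixpoint eval (e : nat -> R) (t : term) : R :=
  match t with
  | Var k => e k
  | Plus t1 t2 => eval e t1 + eval e t2
  | App f ts => fint (fun i => eval e (ts i))
  end.

Definition env_cons (a : R) (e : nat -> R) (k : nat) : R :=
  if k is k'.+1 then e k' else a.

Fixpoint sat (e : nat -> R) (phi : formula) : Prop :=
  match phi with
  | Eq t1 t2 => eval e t1 = eval e t2
  | Lt t1 t2 => eval e t1 < eval e t2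
  | Rel r ts => rint (fun i => eval e (ts i))
  | Neg p => ~ sat e p
  | And p q => sat e p /\ sat e q
  | Ex p => exists a : R, sat (env_cons a e) p
  end.

(* x_0, ..., x_(n-1), c_0, c_1, ... *)
Definition env_of n (x : 'rV[R]_n) (c : nat -> R) (k : nat) : R :=
  if insub k is Some i then x 0 i else c (k - n)%N.

(* The sequence [c] provides the parameters; a formula uses finitely many. *)
Definition definable n (X : set 'rV[R]_n) : Prop :=
  exists (phi : formula) (c : nat -> R),
    forall x, X x <-> sat (env_of x c) phi.

End FirstOrder.

Section OmegaOrderable.
Context {R : realType}.
Variable M : expansion R.

(* (X, le) is isomorphic to (nat, <=); [le] is only considered on X. *)
Definition order_type_omega T (X : set T) (le : T -> T -> Prop) : Prop :=
  exists2 f : nat -> T, set_bij [set: nat] X f &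
    forall i j : nat, le (f i) (f j) <-> (i <= j)%N.

Definition omega_orderable n (X : set 'rV[R]_n) : Prop :=
  definable M X /\
  (finite_set X \/
   exists2 le : 'rV[R]_n -> 'rV[R]_n -> Prop,
     definable M [set v : 'rV[R]_(n + n) | le (lsubmx v) (rsubmx v)] &
     order_type_omega X le).

Definition defines_dense_omega_orderable : Prop :=
  exists2 D : set R,
    omega_orderable [set v : 'rV[R]_1 | D (v 0 0)] &
    exists a b : R, a < b /\ `]a, b[ `<=` closure (D `&` `]a, b[).

(* The 2 + n coordinates of [v] below are r, s, x. *)
Definition D_Sigma n (A : set 'rV[R]_n) : Prop :=
  exists X : R -> R -> set 'rV[R]_n,
    [/\ definable M [set v : 'rV[R]_(2 + n) |
          let r := lsubmx v 0 0 in let s := lsubmx v 0 1 in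
          [/\ 0 < r, 0 < s & X r s (rsubmx v)]],
        forall r s, 0 < r -> 0 < s -> compact (X r s),
        forall r r' s s', 0 < r -> 0 < r' -> 0 < s -> 0 < s' ->
          r <= r' -> s' <= s -> X r s `<=` X r' s'
      & A = [set x | exists r s, [/\ 0 < r, 0 < s & X r s x]]].

End OmegaOrderable.

Definition nowhere_dense (T : topologicalType) (A : set T) : Prop :=
  interior (closure A) = set0.

Section LebesgueOuterMeasure.
Context {R : realType} (n : nat).

Definition box (a b : 'rV[R]_n) : set 'rV[R]_n :=
  [set x | forall i, x 0 i \in `]a 0 i, b 0 i]].

Definition box_volume (a b : 'rV[R]_n) : R := \prod_i (b 0 i - a 0 i).

(* Infimum of the total volumes of the countable covers by boxes.  Covers are
   indexed by an arbitrary D : set nat so that the empty cover is allowed: for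
   n = 0 the only box is the whole space, of volume 1. *)
Definition lebesgue_outer_measure (A : set 'rV[R]_n) : \bar R :=
  ereal_inf [set m | exists (D : set nat) (a b : nat -> 'rV[R]_n),
    [/\ forall k i, a k 0 i <= b k 0 i,
        A `<=` \bigcup_(k in D) box (a k) (b k)
      & m = \esum_(k in D) (box_volume (a k) (b k))%:E]].

(* The null sets of the (completed) n-dimensional Lebesgue measure. *)
Definition lebesgue_null (A : set 'rV[R]_n) : Prop :=
  lebesgue_outer_measure A = 0%E.

End LebesgueOuterMeasure.

(* Main.v *)
Require Import Defs.
From HB Require Import structures.
From mathcomp Require Import all_boot all_order all_algebra.
From mathcomp Require Import all_classical all_reals all_analysis.
From mathcomp Require Import measurable_realfun.
From mathcomp Require Import lra.
Set Implicit Arguments.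
Unset Strict Implicit.
Unset Printing Implicit Defensive.
Import Order.TTheory GRing.Theory Num.Theory.
Import numFieldNormedType.Exports.
Local Open Scope classical_set_scope.
Local Open Scope ring_scope.

(** Write A as the union of the compact sets X r s. The heart of the matter is the
    real line, where a definable set D fails to be dense in any interval as soon as
    it is the union of finite sets E d, d in L, for a definable set L of positive
    numbers with finitely many elements above each of them: ordering D by the
    largest d with x in E d, and then by <, makes it omega-orderable
    ([levelled_not_dense]). Sets L and E come from gaps, the bounded components of
    the complement of a compact set, since only finitely many gaps are longer than
    a given d.

    Measure on the line ([compact_null_line]). If a definable compact set K without
    interior had positive measure, then K - K would contain an interval by the
    theorem of Steinhaus. The ends of gaps are dense in K, so their differences
    would be dense in that interval, and they are levelled by the lengths of gaps.

    Category on the line ([baire_category_line]). Suppose that the union of the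
    X r s is dense in an interval although no X r s has interior. First one needs a
    definable sequence tending to 0 ([scale_exists]). It consists of the least
    distances in the members of an infinite chain of finite sets: the sets of ends
    of long gaps of an infinite X r s or, if all X r s are finite, the sets X r s
    for some fixed s or their unions over r. Letting s, the fineness of the
    approximation of the union over r by a single X r s, and the length of gaps run
    through this sequence produces a dense levelled set of ends of gaps.

    Several variables. Both statements follow by induction on the dimension, by
    cutting R x R^n along fibres. For category ([baire_category]), generic fibres
    meet every rational cube of a given cube, hence contain a rational cube; the Baire theorem in R
    makes one rational cube serve a whole interval of fibres. For measure
    ([compact_null]), the fibres containing a cube form a null set of values by the
    case of the line, the other fibres are null by induction, and a Fubini argument
    for compact sets ([null_fubini]) concludes.

    The remaining implication, that a null set has no interior, says that the outer
    measure of a box is its volume ([outer_box]). *)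

(** * Definable predicates on assignments *)

Section Definability.
Context {R : realType}.
Variable M : expansion R.

Fixpoint tsubst (f : nat -> term M) (t : term M) : term M :=
  match t with
  | Var k => f k
  | Plus t1 t2 => Plus (tsubst f t1) (tsubst f t2)
  | App g ts => App (fun i => tsubst f (ts i))
  end.

Definition lift_subst (f : nat -> term M) (k : nat) : term M :=
  if k is k'.+1 then tsubst (fun j => Var M j.+1) (f k') else Var M 0.

Fixpoint subst (f : nat -> term M) (phi : formula M) : formula M :=
  match phi with
  | Eq t1 t2 => Eq (tsubst f t1) (tsubst f t2)
  | Lt t1 t2 => Lt (tsubst f t1) (tsubst f t2)
  | Rel r ts => Rel (fun i => tsubst f (ts i))
  | Neg p => Neg (subst f p)
  | And p q => And (subst f p) (subst f q)
  | Ex p => Ex (subst (lift_subst f) p)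
  end.

Lemma eval_tsubst (e : nat -> R) f (t : term M) :
  Defs.eval e (tsubst f t) = Defs.eval (fun k => Defs.eval e (f k)) t.
Proof.
elim: t => //= [t1 -> t2 -> //|g ts ih].
by congr fint; apply/funext => i; exact: ih.
Qed.

Lemma sat_subst phi (e : nat -> R) f :
  sat e (subst f phi) <-> sat (fun k => Defs.eval e (f k)) phi.
Proof.
elim: phi e f => /= [t1 t2|t1 t2|r ts|p ih|p ihp q ihq|p ih] e f.
- by rewrite !eval_tsubst.
- by rewrite !eval_tsubst.
- suff -> : (fun i => Defs.eval e (tsubst f (ts i))) =
    (fun i => Defs.eval (fun k => Defs.eval e (f k)) (ts i)) by [].
  by apply/funext => i; exact: eval_tsubst.
- by split=> h /ih.
- by rewrite ihp ihq.
- suff h a : (fun k => Defs.eval (env_cons a e) (lift_subst f k)) =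
             env_cons a (fun k => Defs.eval e (f k)).
    by split=> -[a] hp; exists a; move/ih: hp || apply/ih; rewrite h.
  by apply/funext => -[//|k] /=; rewrite eval_tsubst.
Qed.

(** Interleaving an assignment with a parameter sequence leaves infinitely many
    variables to both, so that neither arities nor the number of parameters
    have to be tracked. *)
Definition mix (e c : nat -> R) (k : nat) : R := if odd k then c k./2 else e k./2.

Lemma mix_even (e c : nat -> R) k : mix e c k.*2 = e k.
Proof. by rewrite /mix odd_double doubleK. Qed.

Lemma mix_odd (e c : nat -> R) k : mix e c k.*2.+1 = c k.
Proof. by rewrite /mix /= odd_double /= uphalf_double. Qed.

Definition dset (P : (nat -> R) -> Prop) : Prop :=
  exists (phi : formula M) (c : nat -> R), forall e, P e <-> sat (mix e c) phi.

Definition dterm (t : (nat -> R) -> R) : Prop :=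
  exists (tm : term M) (c : nat -> R), forall e, t e = Defs.eval (mix e c) tm.

Lemma dterm_var k : dterm (fun e => e k).
Proof. by exists (Var M k.*2), (fun=> 0) => e /=; rewrite mix_even. Qed.

Lemma dterm_const a : dterm (fun=> a).
Proof. by exists (Var M 1), (fun=> a) => e. Qed.

Lemma dset_ext P Q : (forall e, P e <-> Q e) -> dset Q -> dset P.
Proof. by move=> PQ [phi [c h]]; exists phi, c => e; rewrite PQ. Qed.

Lemma dset_not P : dset P -> dset (fun e => ~ P e).
Proof. by move=> [phi [c h]]; exists (Neg phi), c => e /=; rewrite h. Qed.

(** Countably many parameter sequences are packed into one, using a pairing of
    the natural numbers. *)
Lemma dset_subst P (t : nat -> (nat -> R) -> R) :
  (forall k, dterm (t k)) -> dset P -> dset (fun e => P (fun k => t k e)).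
Proof.
move=> /choice [tm /choice [c tmc]] [phi [d Pphi]].
pose pr (p : nat * nat) := (pickle p).
pose g k := if unpickle k is Some (i, j) then
  (if i is i'.+1 then c i' j else d j) else 0.
pose shift i k := Var M (if odd k then (pr (i, k./2)).*2.+1 else k).
have gE i j : g (pr (i, j)) = if i is i'.+1 then c i' j else d j.
  by rewrite /g /pr pickleK.
exists (subst (fun k => if odd k then Var M (pr (0%N, k./2)).*2.+1
                   else tsubst (shift k./2.+1) (tm k./2)) phi), g => e.
rewrite sat_subst Pphi; suff -> : mix (fun k => t k e) d = fun k =>
    Defs.eval (mix e g) (if odd k then Var M (pr (0%N, k./2)).*2.+1
                   else tsubst (shift k./2.+1) (tm k./2)) by [].
apply/funext => k; rewrite {1}/mix; case: ifP => ok.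
  by rewrite /= mix_odd gE.
rewrite eval_tsubst tmc; congr Defs.eval; apply/funext => j /=.
by rewrite {1}/mix; case: ifP => oj; [rewrite mix_odd gE | rewrite /mix oj].
Qed.

Lemma dset_and P Q : dset P -> dset Q -> dset (fun e => P e /\ Q e).
Proof.
move=> [phi [c hP]] [psi [d hQ]].
exists (And (subst (fun k => Var M (if odd k then k./2.*2.*2.+1 else k)) phi)
   (subst (fun k => Var M (if odd k then k./2.*2.+1.*2.+1 else k)) psi)), (mix c d) => e.
rewrite /= !sat_subst hP hQ.
suff [<- <-] : mix e c = (fun k => Defs.eval (mix e (mix c d))
        (Var M (if odd k then k./2.*2.*2.+1 else k))) /\
  mix e d = (fun k => Defs.eval (mix e (mix c d))
        (Var M (if odd k then k./2.*2.+1.*2.+1 else k))) by [].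
by split; apply/funext => k /=; rewrite {1}/mix; case: ifP => ok;
  rewrite ?mix_odd ?mix_even // /mix ok.
Qed.

Lemma dset_or P Q : dset P -> dset Q -> dset (fun e => P e \/ Q e).
Proof.
move=> hP hQ; apply: (@dset_ext _ (fun e => ~ (~ P e /\ ~ Q e))).
  by move=> e; rewrite not_andE !notE.
by apply/dset_not/dset_and; apply: dset_not.
Qed.

Lemma dset_imp P Q : dset P -> dset Q -> dset (fun e => P e -> Q e).
Proof.
move=> hP hQ; apply: (@dset_ext _ (fun e => ~ P e \/ Q e)).
  by move=> e; rewrite implyE.
by apply: dset_or => //; exact: dset_not.
Qed.

Definition tail (e : nat -> R) (k : nat) := e k.+1.

(** The new variable is index [0], as in [Ex], and the interleaved positions of
    the others have to be shifted accordingly. *)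
Lemma dset_ex (P : (nat -> R) -> R -> Prop) :
  dset (fun e => P (tail e) (e 0%N)) -> dset (fun e => exists a, P e a).
Proof.
move=> [phi [c h]].
exists (Ex (subst (fun k => Var M (if odd k then k.+1 else k.-1)) phi)), c => e /=.
suff E a : P e a <-> sat (env_cons a (mix e c))
    (subst (fun k => Var M (if odd k then k.+1 else k.-1)) phi).
  by split=> -[a /E]; exists a.
rewrite sat_subst /=; have := h (env_cons a e); rewrite /= => ->.
suff -> : mix (env_cons a e) c = fun k =>
  env_cons a (mix e c) (if odd k then k.+1 else k.-1) by [].
apply/funext => k; case: ifP => ok; first by rewrite /= /mix ok.
case: k ok => [|[|k]] ok; rewrite {1}/mix ok //=.
by move: ok; rewrite /mix /= negbK => ->.
Qed.

Lemma dset_all (P : (nat -> R) -> R -> Prop) :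
  dset (fun e => P (tail e) (e 0%N)) -> dset (fun e => forall a, P e a).
Proof.
move=> h; apply: (@dset_ext _ (fun e => ~ exists a, ~ P e a)).
  by move=> e; rewrite -forallNE; split=> hP a; [apply|apply: contrapT (hP a)].
by apply/dset_not/dset_ex/dset_not.
Qed.

Lemma dset_true : dset (fun=> True).
Proof. by exists (Eq (Var M 0) (Var M 0)), (fun=> 0). Qed.

Lemma dset_lt t u : dterm t -> dterm u -> dset (fun e => t e < u e).
Proof.
move=> ht hu; pose tt k := if k is 0%N then t else u.
apply: (@dset_subst (fun e => e 0%N < e 1%N) tt) => [[|k] //|].
by exists (Lt (Var M 0) (Var M 2)), (fun=> 0) => e; split.
Qed.

Lemma dset_le t u : dterm t -> dterm u -> dset (fun e => t e <= u e).
Proof.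
move=> ht hu; apply: (@dset_ext _ (fun e => ~ u e < t e)).
  by move=> e; rewrite leNgt; split=> /negP.
exact/dset_not/dset_lt.
Qed.

Lemma dset_eq t u : dterm t -> dterm u -> dset (fun e => t e = u e).
Proof.
move=> ht hu; apply: (@dset_ext _ (fun e => t e <= u e /\ u e <= t e)).
  by move=> e; split=> [->//|[h1 h2]]; apply/eqP; rewrite eq_le h1.
by apply: dset_and; exact: dset_le.
Qed.

Lemma dterm_add t u : dterm t -> dterm u -> dterm (fun e => t e + u e).
Proof.
move=> [t1 [c tE]] [t2 [d uE]].
exists (Plus (tsubst (fun k => Var M (if odd k then k./2.*2.*2.+1 else k)) t1)
   (tsubst (fun k => Var M (if odd k then k./2.*2.+1.*2.+1 else k)) t2)), (mix c d).
move=> e /=; rewrite !eval_tsubst tE uE.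
by congr +%R; congr Defs.eval; apply/funext => k /=; rewrite {1}/mix;
  case: ifP => ok; rewrite ?mix_odd ?mix_even // /mix ok.
Qed.

Lemma dset_forall_fin (I : finType) (P : I -> (nat -> R) -> Prop) :
  (forall i, dset (P i)) -> dset (fun e => forall i, P i e).
Proof.
move=> hP; pose Q (s : seq I) e := forall i, i \in s -> P i e.
suff h s : dset (Q s).
  apply: dset_ext (h (enum I)) => e; split=> [h1 i _ //|h1 i].
  by apply: h1; rewrite mem_enum.
elim: s => [|i s ih]; first by apply: dset_ext dset_true.
apply: (@dset_ext _ (fun e => P i e /\ Q s e)); last exact: dset_and.
move=> e; split=> [h|[h1 h2] j]; last by rewrite inE => /predU1P[->//|]; exact: h2.
by split=> [|j js]; apply: h; rewrite inE ?eqxx// js orbT.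
Qed.

Definition vec n (e : nat -> R) : 'rV[R]_n := \row_i e i.

Lemma vec_surj n (x : 'rV[R]_n) : exists e, x = vec n e.
Proof.
exists (env_of x (fun=> 0)); apply/rowP => i.
by rewrite mxE /env_of insubT//= => h; congr (x _ _); exact: val_inj.
Qed.

(** The [n] existential quantifiers over the coordinates of a vector bind the
    first [n] variables. *)
Definition glue n (f e : nat -> R) (k : nat) : R :=
  if (k < n)%N then f k else e (k - n)%N.

Lemma vec_glue n f e : vec n (glue n f e) = vec n f.
Proof. by apply/rowP => i; rewrite !mxE /glue ltn_ord. Qed.

(** A formula about the first [n] variables may mention others; these are given
    the value [0], which costs one more parameter. *)
Lemma definable_dset n (X : set 'rV[R]_n) :
  definable M X <-> dset (fun e => X (vec n e)).
Proof.
split=> [[phi [c h]]|[phi [c h]]].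
  exists (subst (fun k => Var M (if (k < n)%N then k.*2 else (k - n).*2.+1)) phi), c => e.
  rewrite h sat_subst /=.
  suff -> : env_of (vec n e) c =
    fun k => mix e c (if (k < n)%N then k.*2 else (k - n).*2.+1) by [].
  apply/funext => k; rewrite /env_of; case: ifP => kn.
    by rewrite insubT /= mxE mix_even.
  by rewrite insubF // mix_odd.
exists (subst (fun k => Var M (if odd k then (n + k./2).+1 else
   if (k./2 < n)%N then k./2 else n)) phi), (fun k => if k is k'.+1 then c k' else 0).
move=> x; have [f ->] := vec_surj x.
rewrite -(vec_glue n f (fun=> 0)) h sat_subst vec_glue /=.
set e1 := mix _ _; set e2 := fun k : nat => _; suff -> : e1 = e2 by [].
apply/funext => k; rewrite /e1 /e2 /mix /glue /env_of; case: ifP => ok.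
  rewrite insubF; last by rewrite ltnNge leqW ?leq_addr.
  by rewrite subSn ?leq_addr// addKn.
by case: ifP => kn; [rewrite insubT /= mxE | rewrite insubF ?ltnn // subnn].
Qed.

Lemma dset_ex_vec n (P : (nat -> R) -> 'rV[R]_n -> Prop) :
  dset (fun e => P (fun k => e (n + k)%N) (vec n e)) -> dset (fun e => exists x, P e x).
Proof.
move=> h; apply: (@dset_ext _ (fun e => exists f, P e (vec n f))).
  move=> e; split=> [[x]|[f]]; last by exists (vec n f).
  by have [f ->] := vec_surj x; exists f.
pose Q e := P (fun k => e (n + k)%N) (vec n e).
apply: (@dset_ext _ (fun e => exists f, Q (glue n f e))).
  have gE f e : (fun k => glue n f e (n + k)%N) = e.
    by apply/funext => k; rewrite /glue ltnNge leq_addr /= addKn.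
  by move=> e; rewrite /Q; split=> -[f hf]; exists f; move: hf; rewrite vec_glue gE.
have {h} : dset Q by [].
move: Q => Q; elim: n Q {P} => [|n ih] Q h.
  apply: dset_ext h => e; rewrite /glue; have E f : (fun k => if (k < 0)%N then f k else
    e (k - 0)%N) = e by apply/funext => k; rewrite subn0.
  by split=> [[f]|he]; [rewrite E|exists e; rewrite E].
pose Q' (e : nat -> R) := exists a, Q (env_cons a e).
have /ih hQ' : dset Q'.
  apply: dset_ex; apply: dset_ext h => e.
  by suff -> : env_cons (e 0%N) (tail e) = e by []; apply/funext => -[].
apply: dset_ext hQ' => e; split=> [[f hf]|[f [a ha]]].
  exists (tail f); exists (f 0%N); move: hf.
  by congr Q; apply/funext => -[|k] //=; rewrite /glue.
exists (env_cons a f); move: ha.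
by congr Q; apply/funext => -[|k] //=; rewrite /glue.
Qed.

End Definability.

Lemma finite_set_inj (T U : Type) (f : T -> U) (A : set T) (B : set U) :
  (forall x, A x -> B (f x)) -> (forall x y, A x -> A y -> f x = f y -> x = y) ->
  finite_set B -> finite_set A.
Proof.
move=> AB finj /(finite_image Some) finB.
pose g x := if pselect (A x) then Some (f x) else None.
have gA x : A x -> g x = Some (f x) by rewrite /g; case: pselect.
have : finite_set (g @^-1` (Some @` B)).
  apply: finite_preimage finB => x y; rewrite !inE /g /=.
  case: pselect => [Ax|_ []//]; case: pselect => [Ay _ _ [] /finj -> //|_ _ []//].
by apply: sub_finite_set => x Ax /=; exists (f x); [exact: AB|rewrite gA].
Qed.

(** * Separated sets and gaps on the real line *)

Section RealLine.
Context {R : realType}.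
Implicit Types (S : set R) (Z : R -> set R).

Definition separated (eta : R) S :=
  forall x y, S x -> S y -> x < y -> x + eta <= y.

(** Cells of length [eta] contain at most one point each. *)
Lemma separated_finite (a b eta : R) S :
  0 < eta -> S `<=` `[a, b] -> separated eta S -> finite_set S.
Proof.
move=> eta0 Sab sepS.
pose f x := Num.truncn ((x - a) / eta).
have fP x : S x -> (f x)%:R * eta <= x - a < (f x).+1%:R * eta.
  move=> /Sab; rewrite /= in_itv /= => /andP[ax _].
  rewrite -ler_pdivlMr// -ltr_pdivrMr//; apply: truncn_itv.
  by rewrite divr_ge0 ?subr_ge0// ltW.
have finj x y : S x -> S y -> f x = f y -> x < y -> False.
  move=> Sx Sy fxy xy; have := sepS _ _ Sx Sy xy.
  move: (fP _ Sx) (fP _ Sy); rewrite fxy => /andP[h1 h2] /andP[h3 h4].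
  move: h4; rewrite -natr1 mulrDl mul1r; lra.
apply: (@finite_set_inj _ _ f _ `I_(Num.truncn ((b - a) / eta)).+1); last exact: finite_II.
  move=> x /Sab; rewrite /= in_itv /= => /andP[ax xb].
  by rewrite ltnS; apply: le_truncn; rewrite ler_pM2r ?invr_gt0//; lra.
move=> x y Sx Sy fxy; apply: contrapT => /eqP.
by rewrite neq_lt => /orP[]; [exact: finj|exact/finj/esym].
Qed.

Lemma finite_set_closed S : finite_set S -> closed S.
Proof. by apply: (iffLR accessible_finite_set_closed); exact/hausdorff_accessible. Qed.

(** [u] and [v] are the endpoints of a bounded connected component of the
    complement of [S]. *)
Definition gap S (u v : R) :=
  [/\ S u, S v, u < v & forall w, u < w -> w < v -> ~ S w].

(** Two-sided, because an isolated maximum of [S] is only the right end of a gap,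
    and an isolated minimum only the left end. *)
Definition gap_end S (eta u : R) :=
  exists v, (gap S u v /\ u + eta <= v) \/ (gap S v u /\ v + eta <= u).

Lemma compact_has_max S : compact S -> S !=set0 ->
  exists2 u, S u & forall x, S x -> x <= u.
Proof.
move=> cS S0; have [|u Su hu] := compact_EVT_max (f := id) S0 cS.
  by apply: continuous_subspaceT => x; exact: cvg_id.
by exists u; [rewrite inE in Su|move=> x Sx; apply: hu; rewrite inE].
Qed.

Lemma compact_has_min S : compact S -> S !=set0 ->
  exists2 u, S u & forall x, S x -> u <= x.
Proof.
move=> cS S0; have [|u Su hu] := compact_EVT_min (f := id) S0 cS.
  by apply: continuous_subspaceT => x; exact: cvg_id.
by exists u; [rewrite inE in Su|move=> x Sx; apply: hu; rewrite inE].
Qed.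

Lemma compactI_itv S a b : compact S -> compact (S `&` `[a, b]).
Proof. by move=> cS; apply: compact_closedI => //; exact: itv_closed. Qed.

Lemma gap_around S x w y : compact S -> S x -> S y -> x < w -> w < y -> ~ S w ->
  exists u v, [/\ gap S u v, x <= u, u < w, w < v & v <= y].
Proof.
move=> cS Sx Sy xw wy nSw.
have [|u [Su]] := compact_has_max (compactI_itv (a := x) (b := w) cS).
  by exists x; split => //=; rewrite in_itv /= lexx ltW.
rewrite /= in_itv /= => /andP[xu uw] umax.
have [|v [Sv]] := compact_has_min (compactI_itv (a := w) (b := y) cS).
  by exists y; split => //=; rewrite in_itv /= lexx ltW.
rewrite /= in_itv /= => /andP[wv vy] vmin.
have {}uw : u < w by rewrite lt_neqAle uw andbT; apply/eqP => uw'; rewrite -uw' in nSw.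
have {}wv : w < v by rewrite lt_neqAle wv andbT; apply/eqP => uw'; rewrite uw' in nSw.
exists u, v; split => //; split => //; first exact: lt_trans wv.
move=> z uz zv Sz; have [zw|wz] := leP z w.
  have : z <= u by apply: umax; split=> //=; rewrite in_itv /= zw andbT; lra.
  by rewrite leNgt uz.
have : v <= z by apply: vmin; split=> //=; rewrite in_itv /= ltW //=; lra.
by rewrite leNgt zv.
Qed.

Definition no_interval S := forall c d : R, c < d -> exists2 w, c < w < d & ~ S w.

(** An isolated point is itself the end of a gap, any other point has gaps
    arbitrarily close to it. *)
Lemma gap_end_near S x y e : compact S -> no_interval S -> S x -> S y -> x != y ->
  0 < e -> exists u eta, [/\ 0 < eta, gap_end S eta u & `|u - x| < e].
Proof.
move=> cS nS Sx Sy xy e0; move: xy; rewrite neq_lt => /orP[xy|yx].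
  have [|w /andP[xw]] := nS x (Num.min y (x + e)); first by rewrite lt_min xy; lra.
  rewrite lt_min => /andP[wy we] nSw.
  have [u [v [g xu uw wv vy]]] := gap_around cS Sx Sy xw wy nSw.
  exists u, (v - u); split; [lra|exists v; left; split=> //; lra|].
  by rewrite ger0_norm; lra.
have [|w /andP[]] := nS (Num.max y (x - e)) x; first by rewrite gt_max yx; lra.
rewrite gt_max => /andP[yw ew] wx nSw.
have [u [v [g yu uw wv vx]]] := gap_around cS Sy Sx yw wx nSw.
exists v, (v - u); split; [lra|exists u; right; split=> //; lra|].
by rewrite ler0_norm; lra.
Qed.

Lemma gap_ltP S u v u' v' : gap S u v -> gap S u' v' -> u < u' -> v <= u'.
Proof.
move=> [Su Sv uv h] [Su' Sv' uv' h'] uu'; rewrite leNgt; apply/negP => u'v.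
exact: (h u').
Qed.

Lemma gap_end_finite a b eta S : S `<=` `[a, b] -> 0 < eta ->
  finite_set (gap_end S eta).
Proof.
move=> Sab eta0.
pose A := [set u | exists v, gap S u v /\ u + eta <= v].
pose B := [set u | exists v, gap S v u /\ v + eta <= u].
apply: (@sub_finite_set _ _ (A `|` B)).
  by move=> u [v [h|h]]; [left|right]; exists v.
rewrite finite_setU; split; apply: (separated_finite eta0 (a := a) (b := b)).
- by move=> u [v [[Su _ _ _] _]]; exact: Sab.
- move=> x y [v [g h]] [v' [g' h']] xy; apply: le_trans h _; exact: gap_ltP g g' xy.
- by move=> u [v [[_ Su _ _] _]]; exact: Sab.
- move=> x y [v [g h]] [v' [g' h']] xy; apply: le_trans h'; rewrite lerD2r.
  have [vv'|] := ltP v v'; first exact: gap_ltP g g' vv'.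
  rewrite le_eqVlt => /orP[/eqP vv'|v'v].
    have [_ _ vx hh] := g; have [_ Sy _ _] := g'; have [_ Sx vv _] := g'.
    by case: g' => _ _ _ /(_ x); rewrite vv' => /(_ vx xy); case: g.
  by have := gap_ltP g' g v'v; case: g => _ _ ? _; lra.
Qed.

Lemma gap_end_mono S eta eta' u : eta' <= eta -> gap_end S eta u -> gap_end S eta' u.
Proof.
by move=> h [v [[g hv]|[g hv]]]; exists v; [left|right]; split=> //; lra.
Qed.

Lemma gap_end_sub S eta : gap_end S eta `<=` S.
Proof. by move=> u [v [[[]]|[[]]]]. Qed.

(** The ends of gaps are dense in [S]; finitely many of them would exhaust it. *)
Lemma infinite_gap_ends S : compact S -> no_interval S -> infinite_set S ->
  infinite_set [set u | exists2 eta, 0 < eta & gap_end S eta u].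
Proof.
move=> cS nS iS; set F := [set u | _] => finF; apply: (iS).
apply: sub_finite_set (finF) => x Sx.
have [[y [Sy xy]]|hS] := pselect (exists y, S y /\ x != y); last first.
  case: iS; apply: sub_finite_set (finite_set1 x) => y Sy; apply: contrapT => yx.
  by apply: hS; exists y; split=> //; apply/eqP => xy; exact: yx.
suff : closure F x.
  by rewrite -(closure_id F).1 //; exact: finite_set_closed.
move=> V /nbhs_ballP[e /= e0 eV].
have [u [eta [eta0 hu ux]]] := gap_end_near cS nS Sx Sy xy e0.
exists u; split; first by exists eta.
by apply: eV; rewrite /ball /= distrC.
Qed.

(** Finitely many conditions, each true for large [r], hold from some [r] on. *)
Lemma finite_uniform (T : Type) (F : set T) (Q : T -> R -> Prop) :
  finite_set F ->
  (forall j, F j -> exists2 r0, 0 < r0 & forall r, r0 <= r -> Q j r) ->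
  exists2 r0, 0 < r0 & forall j, F j -> forall r, r0 <= r -> Q j r.
Proof.
move=> finF hQ.
have /choice[g hg] j : exists y, F j -> 0 < y /\ forall r, y <= r -> Q j r.
  have [Fj|nFj] := pselect (F j); last by exists 0.
  by have [r0 h1 h2] := hQ _ Fj; exists r0.
have /compact_has_max : compact (g @` F) by exact/finite_compact/finite_image.
have [F0 hmax|nF] := pselect (F !=set0).
  have [|_ [j0 Fj0 <-] hu] := hmax; first by case: F0 => j Fj; exists (g j), j.
  exists (g j0) => [|j Fj r jr]; first by have [] := hg _ Fj0.
  by apply: (hg _ Fj).2; apply: le_trans jr; apply: hu; exists j.
by move=> _; exists 1 => // j Fj; case: nF; exists j.
Qed.

Definition min_gap S (d : R) := [/\ 0 < d, exists x, S x /\ S (x + d) &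
  forall x y, S x -> S y -> x < y -> x + d <= y].

(** The members of the chain that are [eta]-separated have an [eta]-separated
    union, which is finite, and [d] is a difference of two of its elements. *)
Lemma min_gap_finite a b Z (eta : R) : 0 < eta ->
  (forall t, Z t `<=` `[a, b]) ->
  (forall t t', Z t `<=` Z t' \/ Z t' `<=` Z t) ->
  finite_set [set d | eta <= d /\ exists t, min_gap (Z t) d].
Proof.
move=> eta0 Zab Zchain.
pose U := [set x | exists t, separated eta (Z t) /\ Z t x].
have finU : finite_set U.
  apply: (separated_finite eta0 (a := a) (b := b)); first by move=> x [t [_ /Zab]].
  move=> x y [t [st Ztx]] [t' [st' Ztx']] xy.
  by case: (Zchain t t') => h; [apply: st' => //; exact: h|apply: st => //; exact: h].
have finUU : finite_set ((fun p => p.2 - p.1) @` (U `*` U)).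
  exact/finite_image/finite_setX.
apply: sub_finite_set finUU => d [ed [t [d0 [x [Ztx Ztxd]] hd]]].
have st : separated eta (Z t).
  by move=> u v Zu Zv /hd -/(_ Zu Zv); apply: le_trans; rewrite lerD2l.
by exists (x, x + d); [split; exists t|rewrite /= addrAC subrr add0r].
Qed.

Lemma min_gap_exists S (x y : R) : finite_set S -> S x -> S y -> x < y ->
  exists2 d, min_gap S d & d <= y - x.
Proof.
move=> finS Sx Sy xy.
pose D := [set d : R | 0 < d /\ exists x, S x /\ S (x + d)].
have finD : finite_set D.
  have finSS : finite_set ((fun p => p.2 - p.1) @` (S `*` S)).
    exact/finite_image/finite_setX.
  apply: sub_finite_set finSS => d [d0 [u [Su Sud]]].
  by exists (u, u + d); rewrite //= addrAC subrr add0r.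
have diffD u v : S u -> S v -> u < v -> D (v - u).
  by move=> Su Sv uv; split; [rewrite subr_gt0|exists u; rewrite addrC subrK].
have [|d [d0 [u Sud]] dmin] := compact_has_min (finite_compact finD).
  by exists (y - x); exact: diffD.
exists d; last by apply: dmin; exact: diffD.
split; [exact: d0|by exists u|move=> v w Sv Sw vw].
by rewrite addrC -lerBrDr; apply: dmin; exact: diffD.
Qed.

(** Otherwise the union of the chain would be [eta]-separated, hence finite. *)
Lemma min_gap_small a b Z (eta : R) : 0 < eta ->
  (forall t, finite_set (Z t)) -> (forall t, Z t `<=` `[a, b]) ->
  (forall t t', Z t `<=` Z t' \/ Z t' `<=` Z t) ->
  infinite_set [set x | exists t, Z t x] ->
  exists d, d < eta /\ exists t, min_gap (Z t) d.
Proof.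
move=> eta0 finZ Zab Zchain; apply: contra_notP => h.
apply: (separated_finite eta0 (a := a) (b := b)); first by move=> x [t /Zab].
move=> x y [t Zx] [t' Zy] xy; rewrite leNgt; apply/negP => yx; apply: h.
have [u [Zux Zuy]] : exists u, Z u x /\ Z u y.
  by case: (Zchain t t') => h; [exists t'|exists t]; split=> //; exact: h.
have [d gd dyx] := min_gap_exists (finZ u) Zux Zuy xy.
by exists d; split; [lra|exists u].
Qed.

End RealLine.

(** * Orders of type omega *)

Section Omega.
Variables (T : choiceType) (D : set T) (le : T -> T -> Prop).
Hypotheses (le_anti : forall x y, D x -> D y -> le x y -> le y x -> x = y)
  (le_trans' : forall x y z, D x -> D y -> D z -> le x y -> le y z -> le x z)
  (le_total' : forall x y, D x -> D y -> le x y \/ le y x)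
  (fin_below : forall x, D x -> finite_set [set y | D y /\ le y x])
  (infD : infinite_set D).

Let le_refl x : D x -> le x x. Proof. by move=> Dx; case: (le_total' Dx Dx). Qed.

Let min_exists (S : set T) x : S `<=` D -> S x ->
  exists2 m, S m & forall y, S y -> le m y.
Proof.
move=> SD Sx; have /finite_seqP[s sE] := fin_below (SD _ Sx).
have memE y : S y -> le y x -> y \in s.
  by move=> Sy yx; suff : [set` s] y by []; rewrite -sE; split=> //; exact: SD.
suff [m [Sm ms hm]] : exists m, [/\ S m, m \in s & forall y, y \in s -> S y -> le m y].
  have mx : le m x by have : [set` s] m by []; rewrite -sE => -[].
  exists m => // y Sy; have [yx|xy] := le_total' (SD _ Sy) (SD _ Sx).
    by apply: hm => //; exact: memE.
  by apply: le_trans' xy => //; exact: SD.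
have : exists2 z, z \in s & S z by exists x => //; apply/memE/le_refl/SD.
elim: (s) => [[]//|w r ih] [z zwr Sz].
have [[z' z'r Sz']|nr] := pselect (exists2 z, z \in r & S z); last first.
  have zw : z = w.
    by move: zwr; rewrite inE => /predU1P[//|zr]; case: nr; exists z.
  exists z; split => // y; rewrite inE => /predU1P[->|yr] Sy; last by case: nr; exists y.
  by rewrite zw; apply/le_refl/SD; rewrite -zw.
have [|m [Sm mr hm]] := ih; first by exists z'.
have [Sw|nSw] := pselect (S w); last first.
  exists m; split; rewrite ?inE ?mr ?orbT// => y; rewrite inE => /predU1P[->//|]; exact: hm.
have [mw|wm] := le_total' (SD _ Sm) (SD _ Sw).
  exists m; split; rewrite ?inE ?mr ?orbT// => y; rewrite inE => /predU1P[->//|]; exact: hm.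
exists w; split; rewrite ?inE ?eqxx// => y; rewrite inE => /predU1P[->//|yr] Sy.
  exact/le_refl/SD.
by apply: (le_trans' (y := m)) => //; [exact: SD|exact: SD|exact: SD|exact: hm].
Qed.

(** Enumerate [D] by successive least elements above the last one; a point missed
    by the enumeration would have infinitely many predecessors. *)
Lemma order_type_omegaI : order_type_omega D le.
Proof.
have [x0 Dx0] := infinite_setN0 infD.
have [m0 Dm0 m0min] := min_exists (@subset_refl _ D) Dx0.
have /choice[nxt nxtP] x : exists y, D x ->
    [/\ D y, ~ le y x & forall z, D z -> ~ le z x -> le y z].
  have [Dx|nDx] := pselect (D x); last by exists x.
  have [[z [Dz zx]]|h] := pselect (exists z, D z /\ ~ le z x); last first.
    case: infD; apply: sub_finite_set (fin_below Dx) => y Dy; split=> //.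
    by apply: contrapT => yx; apply: h; exists y.
  have SD : [set w | D w /\ ~ le w x] `<=` D by move=> w [].
  have [y [Dy yx] ymin] := min_exists SD (conj Dz zx).
  by exists y => _; split=> // w Dw wx; exact: ymin.
pose f n := iter n nxt m0.
have Df n : D (f n) by elim: n => //= n ih; have [] := nxtP _ ih.
have fS n : le (f n) (f n.+1) /\ ~ le (f n.+1) (f n).
  have [h1 h2 _] := nxtP _ (Df n); split=> //.
  by have [] := le_total' (Df n) h1.
have fmono i j : (i <= j)%N -> le (f i) (f j).
  elim: j => [|j ih]; first by rewrite leqn0 => /eqP ->; exact: le_refl.
  rewrite leq_eqVlt => /predU1P[->|/ih h]; first exact: le_refl.
  by apply: (le_trans' (y := f j)) => //; exact: (fS j).1.
have fleP i j : le (f i) (f j) <-> (i <= j)%N.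
  split=> [ij|]; last exact: fmono.
  rewrite leqNgt; apply/negP => /fmono h; apply: (fS j).2.
  exact: (le_trans' (y := f i)).
exists f => //; split => [n _ //|i j _ _ fij|x Dx].
  by apply/eqP; rewrite eqn_leq; apply/andP; split; apply/fleP; rewrite fij; exact: le_refl.
apply: contrapT => nx; have fx n : le (f n) x.
  elim: n => [|n ih]; first exact: m0min.
  have [_ _ h] := nxtP _ (Df n); apply: h => // xn; apply: nx; exists n => //.
  exact: le_anti.
apply: infinite_nat; apply: (finite_set_inj (f := f)) (fin_below Dx) => //.
by move=> i j _ _ fij; apply/eqP; rewrite eqn_leq; apply/andP; split; apply/fleP; rewrite fij; exact: le_refl.
Qed.

End Omega.

(** * Definable relations between reals *)

Section Relations.
Context {R : realType}.
Variable M : expansion R.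

Lemma dset1 (L : R -> Prop) t :
  dset M (fun e => L (e 0%N)) -> dterm M t -> dset M (fun e => L (t e)).
Proof. by move=> hL ht; apply: (@dset_subst _ M _ (fun=> t)) hL. Qed.

Lemma dset2 (L : R -> R -> Prop) t u :
  dset M (fun e => L (e 0%N) (e 1%N)) -> dterm M t -> dterm M u ->
  dset M (fun e => L (t e) (u e)).
Proof.
move=> hL ht hu.
by apply: (@dset_subst _ M _ (fun k => if k is 0%N then t else u)) hL => -[].
Qed.

Lemma dset3 (L : R -> R -> R -> Prop) t u v :
  dset M (fun e => L (e 0%N) (e 1%N) (e 2%N)) -> dterm M t -> dterm M u -> dterm M v ->
  dset M (fun e => L (t e) (u e) (v e)).
Proof.
move=> hL ht hu hv.
by apply: (@dset_subst _ M _ (fun k => match k with 0%N => t | 1%N => u | _ => v end)) hL => -[|[]].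
Qed.

End Relations.

Ltac solve_dterm := rewrite /tail /=; repeat apply: dterm_add;
  solve [exact: dterm_var | exact: dterm_const].

(** [tac] deals with the atoms other than comparisons of terms. *)
Ltac solve_dset tac := rewrite /tail /=;
  first [ solve [tac] | apply: dset_ex; solve_dset tac | apply: dset_all; solve_dset tac
  | apply: dset_lt; solve_dterm | apply: dset_le; solve_dterm | apply: dset_eq; solve_dterm
  | apply: dset_and; solve_dset tac | apply: dset_or; solve_dset tac
  | apply: dset_imp; solve_dset tac | apply: dset_not; solve_dset tac ].

(** * Levelled sets *)

Section LineTheorems.
Context {R : realType}.
Variable M : expansion R.
Hypothesis hM : ~ defines_dense_omega_orderable M.

Lemma dset_gap_end (X : R -> R -> set R) t u v w :
  dset M (fun e => X (e 0%N) (e 1%N) (e 2%N)) ->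
  dterm M t -> dterm M u -> dterm M v -> dterm M w ->
  dset M (fun e => gap_end (X (t e) (u e)) (v e) (w e)).
Proof.
move=> hX ht hu hv hw.
pose sub k := match k with 0%N => t | 1%N => u | 2%N => v | _ => w end.
apply: (@dset_subst _ M (fun e => gap_end (X (e 0%N) (e 1%N)) (e 2%N) (e 3%N)) sub).
  by case=> [|[|[]]].
pose gap' e (p q : R) := X (e 0%N) (e 1%N) p /\ X (e 0%N) (e 1%N) q /\ p < q /\
  forall z, p < z -> z < q -> ~ X (e 0%N) (e 1%N) z.
apply: (@dset_ext _ _ _ (fun e => exists z, (gap' e (e 3%N) z /\ e 3%N + e 2%N <= z) \/
  (gap' e z (e 3%N) /\ z + e 2%N <= e 3%N))); last first.
  by rewrite /gap'; solve_dset ltac:(apply: (dset3 hX); solve_dterm).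
have gE e p q : gap (X (e 0%N) (e 1%N)) p q <-> gap' e p q.
  by split=> [[? ? ? ?]|[? [? []]]].
by move=> e; split=> -[z [[/gE g h]|[/gE g h]]]; exists z; [left|right|left|right].
Qed.

(** Ordering [D], the union of the [E d], first by decreasing level, the largest
    [d] with [x] in [E d], then by [<], gives a definable order in which every
    point has finitely many predecessors. *)
Lemma levelled_not_dense (L : set R) (E : R -> set R) (a b : R) :
  dset M (fun e => L (e 0%N)) -> dset M (fun e => E (e 0%N) (e 1%N)) ->
  (forall d, L d -> finite_set [set d' | L d' /\ d <= d']) ->
  (forall d, L d -> finite_set (E d)) -> a < b ->
  ~ (forall c d, a <= c -> c < d -> d <= b ->
     exists x, c < x < d /\ exists2 h, L h & E h x).
Proof.
move=> hL hE finL finE ab dense; apply: hM.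
pose D := [set x | exists2 h, L h & E h x].
pose lev h x := [/\ L h, E h x & forall h', L h' -> E h' x -> h' <= h].
pose le x y := exists h h', [/\ lev h x, lev h' y & h' < h \/ (h = h' /\ x <= y)].
have levE x : D x -> exists h, lev h x.
  move=> [h Lh Ehx].
  have finA : finite_set [set h' | [/\ L h', E h' x & h <= h']].
    by apply: sub_finite_set (finL _ Lh) => h' [].
  have [|m [Lm Em hm] mmax] := compact_has_max (finite_compact finA).
    by exists h.
  exists m; split=> // h' Lh' Eh'; have [hh'|/ltW h'h] := leP h h'; first exact: mmax.
  exact: le_trans hm.
have lev_uniq h h' x : lev h x -> lev h' x -> h = h'.
  move=> [Lh Eh hh] [Lh' Eh' hh']; apply/eqP; rewrite eq_le.
  by rewrite hh'// hh.
have hlev t u : dterm M t -> dterm M u -> dset M (fun e => lev (t e) (u e)).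
  apply: dset2; apply: (@dset_ext _ _ _ (fun e => L (e 0%N) /\ E (e 0%N) (e 1%N) /\
    forall h, L h -> E h (e 1%N) -> h <= e 0%N)).
    by move=> e; split=> [[]|[? []]].
  by solve_dset ltac:(first [apply: (dset1 hL) | apply: (dset2 hE)]; solve_dterm).
have hle : dset M (fun e => le (e 0%N) (e 1%N)).
  apply: (@dset_ext _ _ _ (fun e => exists h h', lev h (e 0%N) /\ lev h' (e 1%N) /\
     (h' < h \/ (h = h' /\ e 0%N <= e 1%N)))).
    by move=> e; split=> -[h [h' H]]; exists h, h'; [case: H|case: H => ? []].
  by solve_dset ltac:(apply: hlev; solve_dterm).
have hD : dset M (fun e => D (e 0%N)).
  apply: (@dset_ext _ _ _ (fun e => exists h, L h /\ E h (e 0%N))).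
    by move=> e; split=> [[h]|[h []]]; exists h.
  by solve_dset ltac:(first [apply: (dset1 hL) | apply: (dset2 hE)]; solve_dterm).
exists D; last first.
  exists a, b; split=> // x; rewrite /= in_itv /= => /andP[ax xb] V /nbhs_ballP[e /= e0 eV].
  have [|||y [/andP[xy yx] Dy]] := dense (Num.max a (x - e)) (Num.min b (x + e)).
  - by rewrite le_max lexx.
  - rewrite lt_min !gt_max; lra.
  - by rewrite ge_min lexx.
  move: xy yx; rewrite gt_max lt_min => /andP[ay xy] /andP[yb yx].
  exists y; split; first by split=> //=; rewrite in_itv /= ay.
  by apply: eV; rewrite /ball /= ltr_norml; lra.
split.
  by apply/definable_dset; apply: dset_ext hD => e /=; rewrite mxE.
have [finD|infD] := pselect (finite_set D); [left|right].
  apply: (@finite_set_inj _ _ (fun v : 'rV[R]_1 => v 0 0)) finD => // v w _ _ vw.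
  by apply/rowP => i; rewrite ord1.
exists (fun v w : 'rV[R]_1 => le (v 0 0) (w 0 0)).
  by apply/definable_dset; apply: dset_ext hle => e; rewrite /= !mxE /=.
have [|||||f [fD finj fsurj] fle] := @order_type_omegaI _ D le.
- move=> x y Dx Dy [h [h' [hx hy hh]]] [k [k' [ky kx kk]]].
  have E1 := lev_uniq _ _ _ hx kx; have E2 := lev_uniq _ _ _ hy ky; subst k k'.
  by case: hh => [?|[? ?]]; case: kk => [?|[? ?]]; lra.
- move=> x y z Dx Dy Dz [h [h' [hx hy hh]]] [k [k' [ky kz kk]]].
  have E2 := lev_uniq _ _ _ hy ky; subst k.
  exists h, k'; split=> //; case: hh => [?|[-> ?]]; case: kk => [?|[<- ?]].
  + by left; lra.
  + by left.
  + by left.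
  + by right; split=> //; lra.
- move=> x y /levE[h hx] /levE[k ky].
  have [hk|kh|hk] := ltgtP h k.
  + by right; exists k, h; split=> //; left.
  + by left; exists h, k; split=> //; left.
  + subst k; have [xy|yx] := leP x y.
      by left; exists h, h; split=> //; right.
    by right; exists h, h; split=> //; right; split=> //; exact: ltW.
- move=> x /levE[h hx]; have Lh : L h by case: hx.
  apply: (@sub_finite_set _ _ (\bigcup_(k in [set k | L k /\ h <= k]) E k)).
    move=> y [Dy [k [k' [ky k'x hh]]]]; rewrite (lev_uniq _ _ _ hx k'x).
    exists k; last by case: ky.
    by split; [case: ky|case: hh => [/ltW|[->]]].
  by apply: bigcup_finite; [exact: finL|move=> k [/finE]].
- by [].

exists (fun n => \row_(_ < 1) f n) => [|i j]; last by rewrite !mxE; exact: fle.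
split=> [n _|i j _ _ /rowP/(_ 0)|v Dv]; rewrite /= ?mxE.
- exact: fD.
- by move=> fij; apply: finj; rewrite ?inE.
- have [n _ fn] := fsurj _ Dv; exists n => //.
  by apply/rowP => i; rewrite mxE fn ord1.
Qed.

End LineTheorems.

(** * The theorem of Steinhaus *)

Lemma compact_ball_sub (R : realType) (T : pseudoMetricType R) (K U : set T) :
  compact K -> open U -> K `<=` U ->
  exists2 e : R, 0 < e & forall x, K x -> ball x e `<=` U.
Proof.
move=> /compact_near_coveringP cK oU KU.
have : \forall e \near 0^'+, K `<=` [set x | ball x e `<=` U].
  apply: (cK _ (0^'+ : set_system R) (fun e x => ball x e `<=` U)) => x Kx.
  have /nbhs_ballP[d /= d0 dU] : nbhs x U by apply: open_nbhs_nbhs; split=> //; exact: KU.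
  exists (ball x (d / 2), [set e | e < d / 2]).
    split=> /=; first by apply: nbhsx_ballx; rewrite divr_gt0.
    by apply: nbhs_right_lt; rewrite divr_gt0.
  move=> [y e] [/= xy ed] z yz; apply: dU; rewrite (splitr d).
  by apply: ball_triangle xy _; apply: le_ball yz; exact: ltW.
move=> h; have [e [e0 he]] := filter_ex (filterI (@nbhs_right_gt R 0) h).
by exists e.
Qed.

Section Steinhaus.
Context {R : realType}.
Local Notation mu := (@lebesgue_measure R).

Lemma measurable_shift (t : R) :
  measurable_fun setT (fun x : measurableTypeR R => (x + t : measurableTypeR R)).
Proof. by apply: continuous_measurable_fun => x; apply: cvgD; [exact: cvg_id|exact: cvg_cst]. Qed.

Lemma lebesgue_measure_shift (t : R) (A : set R) : measurable A ->
  mu ((fun x => x + t) @^-1` A) = mu A.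
Proof.
move=> mA; pose mf := isMeasurableFun.Build _ _ _ _ _ (measurable_shift t).
pose f : {mfun measurableTypeR R >-> measurableTypeR R} :=
  HB.pack (fun x : measurableTypeR R => (x + t : measurableTypeR R)) mf.
rewrite -[LHS]/(pushforward mu f A).
apply/esym/lebesgue_measure_unique => //= _ [[a b]] _ <-; rewrite /pushforward /=.
have -> : (fun x => x + t) @^-1` `]a, b] = `]a - t, b - t]%classic.
  by apply/seteqP; split=> x /=; rewrite !in_itv /= ltrBlDr lerBrDr.
by rewrite !lebesgue_measure_itv /= !lte_fin ltrD2r -!EFinD opprB addrA subrK.
Qed.

(** Otherwise [K] and a small translate of it are disjoint inside an open set
    whose measure is less than twice that of [K]. *)
Lemma steinhaus (K : set R) : compact K -> mu K != 0%E ->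
  exists2 e : R, 0 < e & forall t, `|t| < e -> exists x, K x /\ K (x + t).
Proof.
move=> cK mK0; have mK := compact_measurable cK.
have Kfin : mu K \is a fin_num by rewrite ge0_fin_numE// compact_finite_measure.
have K0 : 0 < fine (mu K).
  by rewrite fine_gt0// lt0e mK0 measure_ge0 /= -ge0_fin_numE.
have [U [oU KU muU]] := lebesgue_regularity_outer mK (compact_finite_measure cK) K0.
have [e e0 he] := compact_ball_sub cK oU KU.
exists e => // t te; apply: contrapT => h.
pose K' := (fun x => x + - t) @^-1` K.
have mK' : measurable K'.
  rewrite -[X in measurable X]setTI; exact: measurable_shift.
have KK' : K `&` K' = set0.
  apply/seteqP; split=> // x [Kx Kx']; apply: h; exists (x - t); split=> //.
  by rewrite subrK.
have K'U : K' `<=` U.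
  by move=> x /he; apply; rewrite /ball /= addrAC subrr add0r normrN.
have mU : measurable U by exact: open_measurable.
have hU : mu U = (mu K + mu (U `\` K))%E.
  rewrite -{1}(setDKU KU) setUC measureU//; first exact: measurableD.
  by rewrite setDE setIC -setIA setICl setI0.
have hK' : (mu K' <= mu (U `\` K))%E.
  apply: le_measure; rewrite ?inE//; first exact: measurableD.
  move=> x Kx'; split; first exact: K'U.
  by move=> Kx; have : set0 x by rewrite -KK'.
have : (mu K' < (fine (mu K))%:E)%E by exact: le_lt_trans muU.
by rewrite fineK// lebesgue_measure_shift// ltxx.
Qed.
End Steinhaus.

(** * Category and measure on the line *)

Section LineCategory.
Context {R : realType}.
Variable M : expansion R.
Hypothesis hM : ~ defines_dense_omega_orderable M.

(** A definable stand-in for a sequence tending to [0]. *)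
Record scale (L : set R) : Prop := Scale {
  scale_dset : dset M (fun e => L (e 0%N));
  scale_gt0 : forall d, L d -> 0 < d;
  scale_finite : forall eta, 0 < eta -> finite_set [set d | L d /\ eta <= d];
  scale_small : forall eta, 0 < eta -> exists2 d, L d & d < eta }.

Lemma chain_scale (a b : R) (Z : R -> set R) :
  dset M (fun e => Z (e 0%N) (e 1%N)) ->
  (forall t, finite_set (Z t)) -> (forall t, Z t `<=` `[a, b]) ->
  (forall t x, Z t x -> 0 < t) ->
  (forall t t', 0 < t -> t <= t' -> Z t `<=` Z t') \/
  (forall t t', 0 < t -> t <= t' -> Z t' `<=` Z t) ->
  infinite_set [set x | exists t, Z t x] -> exists L, scale L.
Proof.
move=> hZ finZ Zab Z0 mono infZ.
have Zchain t t' : Z t `<=` Z t' \/ Z t' `<=` Z t.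
  have [t0|t0] := ltP 0 t; last by left=> x /Z0; lra.
  have [t0'|t0'] := ltP 0 t'; last by right=> x /Z0; lra.
  by case: mono => h; have [tt'|/ltW tt'] := leP t t'; auto.
exists [set d | exists t, min_gap (Z t) d]; split.
- apply: (@dset_ext _ _ _ (fun e => exists t, 0 < e 0%N /\
    (exists x, Z t x /\ Z t (x + e 0%N)) /\
    forall x y, Z t x -> Z t y -> x < y -> x + e 0%N <= y)).
    by move=> e; split=> -[t h]; exists t; [case: h|case: h => ? []].
  by solve_dset ltac:(apply: (dset2 hZ); solve_dterm).
- by move=> d [t []].
- move=> eta eta0; apply: sub_finite_set (min_gap_finite eta0 Zab Zchain).
  by move=> d [].
- move=> eta eta0; have [d [deta hd]] := min_gap_small eta0 finZ Zab Zchain infZ.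
  by exists d.
Qed.

(** A family witnessing that a subset of the line is D_Sigma, extended by the
    empty set outside the positive quadrant. *)
Record dsigma1 (X : R -> R -> set R) : Prop := DSigma1 {
  dsigma1_dset : dset M (fun e => X (e 0%N) (e 1%N) (e 2%N));
  dsigma1_compact : forall r s, compact (X r s);
  dsigma1_mono : forall r r' s s', 0 < s' -> r <= r' -> s' <= s -> X r s `<=` X r' s';
  dsigma1_gt0 : forall r s x, X r s x -> 0 < r /\ 0 < s }.

(** Three chains of finite sets cover all cases: the ends of the gaps longer than
    [t] of an infinite [X r0 s0]; the finite sets [X t s0], with [s0] fixed; the
    unions over [r] of the [X r t]. *)
Lemma scale_exists (a b : R) X : dsigma1 X -> (forall r s, X r s `<=` `[a, b]) ->
  (forall r s, no_interval (X r s)) ->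
  infinite_set [set x | exists r s, X r s x] -> exists L, scale L.
Proof.
move=> [hX cX mX pX] Xab nX infX.
have [[r0 [s0 inf0]]|h1] := pselect (exists r s, infinite_set (X r s)).
  apply: (@chain_scale a b (fun t u => 0 < t /\ gap_end (X r0 s0) t u)).
  - by solve_dset ltac:(apply: (dset_gap_end hX); solve_dterm).
  - move=> t; have [t0|t0] := ltP 0 t.
      by apply: sub_finite_set (gap_end_finite (Xab r0 s0) t0) => u [].
    by apply: (@sub_finite_set _ _ set0) => // u []; lra.
  - by move=> t u [_ /gap_end_sub /Xab].
  - by move=> t u [].
  - by right=> t t' t0 tt' u [t'0 g]; split=> //; exact: gap_end_mono g.
  - apply: sub_infinite_set (infinite_gap_ends (cX r0 s0) (nX r0 s0) inf0).
    by move=> u [eta eta0 g]; exists eta.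
have {}h1 r s : finite_set (X r s).
  by apply: contrapT => h; apply: h1; exists r, s.
have [[s0 inf0]|h2] := pselect (exists s, infinite_set [set x | exists r, X r s x]).
  apply: (@chain_scale a b (fun t => X t s0)) => //.
  - by solve_dset ltac:(apply: (dset3 hX); solve_dterm).
  - by move=> t x /pX[].
  - by left=> t t' t0 tt' x /[dup] /pX[_ s00]; exact: mX.
have {}h2 s : finite_set [set x | exists r, X r s x].
  by apply: contrapT => h; apply: h2; exists s.
apply: (@chain_scale a b (fun t => [set x | exists r, X r t x])) => //.
- by solve_dset ltac:(apply: (dset3 hX); solve_dterm).
- by move=> t x [r /Xab].
- by move=> t x [r /pX[]].
- by right=> t t' t0 tt' x [r Xx]; exists r; apply: mX Xx.
- by apply: sub_infinite_set infX => x [r [s Xx]]; exists s, r.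
Qed.

Definition near_union X (d r s : R) :=
  forall y, (exists r', X r' s y) -> exists x, [/\ X r s x, x < y + d & y < x + d].

(** The infimum of the [r] at which [X r s] comes within [d] of every point of the union
    of the [X r s], plus [1]: this choice is definable, and the approximation holds
    at [rho] even if the infimum is not attained. *)
Definition selected X (d s rho : R) :=
  [/\ 1 <= rho, (forall r, rho < r + 1 -> near_union X d r s) &
    forall r, 0 < r -> r + 1 < rho -> ~ near_union X d r s].

Lemma selected_uniq X d s rho rho' :
  selected X d s rho -> selected X d s rho' -> rho = rho'.
Proof.
move=> [h1 h2 h3] [h1' h2' h3']; apply/eqP; rewrite eq_le !leNgt.
apply/andP; split; apply/negP => h.
  by apply: (h3 ((rho + rho') / 2 - 1)); [lra|lra|apply: h2'; lra].
by apply: (h3' ((rho + rho') / 2 - 1)); [lra|lra|apply: h2; lra].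
Qed.

(** The union over [r] meets finitely many cells of length [d], and [X r s] meets
    all of these for large [r]. *)
Lemma selected_exists (a b : R) X d s : dsigma1 X -> (forall r s, X r s `<=` `[a, b]) ->
  0 < d -> 0 < s -> exists rho, selected X d s rho.
Proof.
move=> [_ _ mX pX] Xab d0 s0.
have up r r' : r <= r' -> near_union X d r s -> near_union X d r' s.
  by move=> rr' h y /h[x [Xx h1 h2]]; exists x; split=> //; apply: mX Xx.
pose cell x := Num.truncn ((x - a) / d).
have cellP r x : X r s x -> (cell x)%:R * d <= x - a < (cell x)%:R * d + d.
  move=> /Xab; rewrite /= in_itv /= => /andP[ax _].
  have -> : (cell x)%:R * d + d = (cell x).+1%:R * d by rewrite -natr1 mulrDl mul1r.
  rewrite -ler_pdivlMr// -ltr_pdivrMr//.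
  by apply: truncn_itv; rewrite divr_ge0 ?subr_ge0// ltW.
pose F := [set j | exists x, (exists r, X r s x) /\ cell x = j].
have finF : finite_set F.
  apply: (@sub_finite_set _ _ `I_(cell b).+1) => [_ [x [[r /Xab xab] <-]]|]; last exact: finite_II.
  move: xab; rewrite /= in_itv /= => /andP[ax xb]; rewrite ltnS; apply: le_truncn.
  by rewrite ler_pM2r ?invr_gt0//; lra.
have [|r0 r00 hr0] := @finite_uniform _ _ F (fun j r => exists x, X r s x /\ cell x = j) finF.
  move=> j [x [[r Xx] xj]]; exists r; first by case: (pX _ _ _ Xx).
  by move=> r' rr'; exists x; split=> //; apply: mX Xx.
have near0 : near_union X d r0 s.
  move=> y [r Xy]; have [|x [Xx xy]] := hr0 (cell y) _ _ (lexx _).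
    by exists y; split=> //; exists r.
  exists x; have := cellP _ _ Xx; have := cellP _ _ Xy; rewrite xy => /andP[? ?] /andP[? ?].
  by split=> //; lra.
pose N := [set r | 0 < r /\ near_union X d r s].
have lbN : has_lbound N by exists 0 => r [/ltW].
have N0 : N !=set0 by exists r0.
have inf0 : 0 <= inf N by apply: lb_le_inf => // r [/ltW].
exists (inf N + 1); split; first lra.
- move=> r; rewrite ltrD2r => /(inf_lt N0)[r' [_ nr'] r'r].
  exact: up (ltW r'r) nr'.
- move=> r rpos; rewrite ltrD2r ltNge => /negP h nr; apply: h.
  by apply: ge_inf.
Qed.

(** Let [X] be a counterexample. [scale_exists] yields a sequence [L] tending to
    [0]; [s] and the mesh of approximation of [selected] range over [L], and the
    countably many sets [X r s] so selected have a dense union. Hence so do the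
    ends of their gaps, and only finitely many gaps are longer than a given
    element of [L]. *)
Theorem baire_category_line (a b : R) X : dsigma1 X -> a < b ->
  (forall c d, a <= c -> c < d -> d <= b -> exists r s x, c < x < d /\ X r s x) ->
  exists r s c d, [/\ c < d, a <= c, d <= b & forall x, c <= x <= d -> X r s x].
Proof.
move=> dX0 ab dense0; apply: contrapT => hno.
pose X' r s := X r s `&` `[a, b].
have X'ab r s : X' r s `<=` `[a, b] by move=> x [].
have dX : dsigma1 X'.
  case: dX0 => hX cX mX pX; split.
  - apply: (@dset_ext _ _ _ (fun e => X (e 0%N) (e 1%N) (e 2%N) /\
      a <= e 2%N /\ e 2%N <= b)) => [e|]; last by solve_dset ltac:(apply: (dset3 hX); solve_dterm).
    rewrite /X' /= in_itv /=; split=> [[? /andP[? ?]] //|[? [? ?]]].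
    by split=> //; apply/andP.
  - by move=> r s; exact: compactI_itv.
  - by move=> r r' s s' h1 h2 h3 x [/mX h ?]; split=> //; exact: h.
  - by move=> r s x [/pX].
have dense c d : a <= c -> c < d -> d <= b -> exists r s x, c < x < d /\ X' r s x.
  move=> ac cd db; have [r [s [x [/andP[cx xd] Xx]]]] := dense0 _ _ ac cd db.
  exists r, s, x; split; first by rewrite cx.
  by split=> //=; rewrite in_itv /=; lra.
have nX r s : no_interval (X' r s).
  move=> c d cd; apply: contrapT => h; apply: hno.
  have X'x x : c < x < d -> X' r s x by move=> cxd; apply: contrapT => ?; apply: h; exists x.
  (* Strictly inside, since [hno] asks for a closed interval. *)
  pose c' := (2 * c + d) / 3; pose d' := (c + 2 * d) / 3.
  have [Xc' /=] : X' r s c' by apply: X'x; rewrite /c'; apply/andP; split; lra.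
  have [Xd' /=] : X' r s d' by apply: X'x; rewrite /d'; apply/andP; split; lra.
  rewrite !in_itv /= => /andP[_ d'b] /andP[ac' _].
  exists r, s, c', d'; split=> //; first by rewrite /c' /d'; lra.
  move=> x /andP[c'x xd']; apply: (X'x _ _).1; move: c'x xd'; rewrite /c' /d'.
  by move=> ? ?; apply/andP; split; lra.
have [hX' cX' mX' pX'] := dX.
have infX' : infinite_set [set x | exists r s, X' r s x].
  move=> finU.
  apply: (@levelled_not_dense _ M hM [set x | x = 1] (fun _ => [set x | exists r s, X' r s x])
    a b) => //.
  - by solve_dset idtac.
  - by solve_dset ltac:(apply: (dset3 hX'); solve_dterm).
  - by move=> d _; apply: sub_finite_set (finite_set1 (1 : R)) => ? [].
  - move=> c d ac cd db; have [r [s [x [cxd Xx]]]] := dense _ _ ac cd db.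
    by exists x; split=> //; exists 1 => //; exists r, s.
have [L [hL L0 finL smallL]] := scale_exists dX X'ab nX infX'.
pose E d x := exists d1 d2 rho, [/\ L d1 /\ d <= d1, L d2 /\ d <= d2,
  selected X' d1 d2 rho & gap_end (X' rho d2) d x].
apply: (@levelled_not_dense _ M hM L E a b) => //.
- have hsel t u v : dterm M t -> dterm M u -> dterm M v ->
      dset M (fun e => selected X' (t e) (u e) (v e)).
    apply: dset3; apply: (@dset_ext _ _ _ (fun e => 1 <= e 2%N /\
      (forall r, e 2%N < r + 1 -> forall y, (exists r', X' r' (e 1%N) y) ->
         exists x, X' r (e 1%N) x /\ x < y + e 0%N /\ y < x + e 0%N) /\
      (forall r, 0 < r -> r + 1 < e 2%N -> ~ forall y, (exists r', X' r' (e 1%N) y) ->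
         exists x, X' r (e 1%N) x /\ x < y + e 0%N /\ y < x + e 0%N))).
      have nE e r : near_union X' (e 0%N) r (e 1%N) <->
          forall y, (exists r', X' r' (e 1%N) y) ->
          exists x, X' r (e 1%N) x /\ x < y + e 0%N /\ y < x + e 0%N.
        by split=> h y /h[x]; [move=> [? ? ?]|move=> [? [? ?]]]; exists x.
      move=> e; split=> [[h1 h2 h3]|[h1 [h2 h3]]].
        by split=> //; split=> [r /h2 /nE|r r0 /(h3 _ r0) h /nE].
      by split=> // [r /h2 /nE|r r0 /(h3 _ r0) h /nE].
    by solve_dset ltac:(apply: (dset3 hX'); solve_dterm).
  apply: (@dset_ext _ _ _ (fun e => exists d1 d2 rho, (L d1 /\ e 0%N <= d1) /\
    (L d2 /\ e 0%N <= d2) /\ selected X' d1 d2 rho /\ gap_end (X' rho d2) (e 0%N) (e 1%N))).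
    move=> e; split=> -[d1 [d2 [rho h]]]; exists d1, d2, rho; first by case: h.
    by case: h => ? [? [? ?]].
  by solve_dset ltac:(first [apply: (dset1 hL); solve_dterm | apply: hsel; solve_dterm |
    apply: (dset_gap_end hX'); solve_dterm]).
- by move=> d /L0; exact: finL.
- move=> d Ld; have d0 := L0 _ Ld.
  pose Ld' := [set d' | L d' /\ d <= d'].
  pose G d1 d2 := [set x | exists rho, selected X' d1 d2 rho /\ gap_end (X' rho d2) d x].
  apply: (@sub_finite_set _ _ (\bigcup_(d1 in Ld') \bigcup_(d2 in Ld') G d1 d2)).
    by move=> x [d1 [d2 [rho [h1 h2 h3 h4]]]]; exists d1 => //; exists d2 => //; exists rho.
  apply: bigcup_finite; [exact: finL|move=> d1 _; apply: bigcup_finite; first exact: finL].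
  move=> d2 _; have [[rho srho]|h] := pselect (exists rho, selected X' d1 d2 rho).
    apply: sub_finite_set (gap_end_finite (X'ab rho d2) d0) => x [rho' [srho']].
    by rewrite (selected_uniq srho srho').
  by apply: (@sub_finite_set _ _ set0) => // x [rho [srho _]]; apply: h; exists rho.
  (* Two points, in different halves, make sure that the selected set has a gap. *)
- move=> c d ac cd db; pose m := (c + d) / 2.
  have [||r1 [s1 [x1 [/andP[cx1 x1m] Xx1]]]] := dense c m ac; rewrite /m; [lra|lra|].
  have [||r2 [s2 [x2 [/andP[mx2 x2d] Xx2]]]] := dense m d _ _ db; rewrite /m; [lra|lra|].
  have [d2 Ld2] : exists2 d2, L d2 & d2 < Num.min s1 s2.
    by apply: smallL; rewrite lt_min (pX' _ _ _ Xx1).2 (pX' _ _ _ Xx2).2.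
  rewrite lt_min => /andP[ds1 ds2].
  have [d1 Ld1] : exists2 d1, L d1 &
     d1 < Num.min (Num.min (x1 - c) (m - x1)) (Num.min (x2 - m) (d - x2)).
    by apply: smallL; rewrite !lt_min !subr_gt0 cx1 x1m mx2.
  rewrite !lt_min => /andP[/andP[e1 e2] /andP[e3 e4]].
  have [rho srho] := selected_exists dX X'ab (L0 _ Ld1) (L0 _ Ld2).
  have [rho1 nrho _] := srho.
  have inU r s x : X' r s x -> d2 < s -> exists r', X' r' d2 x.
    by move=> Xx /ltW ds; exists r; apply: mX' Xx => //; exact: L0.
  have {}nrho : near_union X' d1 rho d2 by apply: nrho; lra.
  have [y1 [Xy1 y1l y1r]] := nrho _ (inU _ _ _ Xx1 ds1).
  have [y2 [Xy2 y2l y2r]] := nrho _ (inU _ _ _ Xx2 ds2).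
  have [||u [eta [eta0 gu]]] := @gap_end_near _ (X' rho d2) y1 y2 (Num.min (y1 - c) (d - y1))
    (cX' _ _) (nX _ _) Xy1 Xy2; [by rewrite lt_eqF//; lra|by rewrite lt_min; lra|].
  rewrite lt_min !ltr_norml => /andP[/andP[u1 u2] /andP[u3 u4]].
  have [h Lh] : exists2 h, L h & h < Num.min eta (Num.min d1 d2).
    by apply: smallL; rewrite !lt_min eta0 !L0.
  rewrite !lt_min => /andP[heta /andP[hd1 hd2]].
  exists u; split; first by apply/andP; split; lra.
  exists h => //; exists d1, d2, rho; split=> //; try by split=> //; exact: ltW.
  by apply: gap_end_mono gu; exact: ltW.
Qed.

(** By Steinhaus' theorem [K - K] would contain an interval, hence the
    differences of ends of gaps of [K] would be dense in it; they are levelled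
    by the lengths of the gaps. *)
Theorem compact_null_line (K : set R) : dset M (fun e => K (e 0%N)) -> compact K ->
  no_interval K -> lebesgue_measure K = 0%E.
Proof.
move=> hK cK nK; apply: contrapT => /eqP K0.
have [e e0 he] := steinhaus cK K0.
have [a [b Kab]] : exists a b, K `<=` `[a, b].
  have [K1|K1] := pselect (K !=set0); last first.
    by exists 0, 0 => x Kx; case: K1; exists x.
  have [a _ ha] := compact_has_min cK K1; have [b _ hb] := compact_has_max cK K1.
  by exists a, b => x Kx /=; rewrite in_itv /= ha// hb.
pose L := [set d : R | 0 < d /\ exists u, gap K u (u + d)].
have lenL d u : 0 < d -> gap_end K d u -> exists l, [/\ L l, d <= l & gap_end K l u].
  move=> d0 [v [[g uv]|[g vu]]].
    exists (v - u); split; [split; [lra|]|lra|exists v; left; split=> //; lra].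
    by exists u; rewrite addrC subrK.
  exists (u - v); split; [split; [lra|]|lra|exists v; right; split=> //; lra].
  by exists v; rewrite addrC subrK.
have fin_diff d : 0 < d ->
    finite_set ((fun p => p.2 - p.1) @` (gap_end K d `*` gap_end K d)).
  by move=> d0; apply/finite_image/finite_setX; exact: gap_end_finite Kab d0.
pose E d z := exists x, gap_end K d x /\ gap_end K d (x + z).
have hKK : dset M (fun e => K (e 2%N)) by apply: (dset1 hK); solve_dterm.
apply: (@levelled_not_dense _ M hM L E 0 e) => //.
- apply: (@dset_ext _ _ _ (fun e => 0 < e 0%N /\ exists u, K u /\ K (u + e 0%N) /\
    u < u + e 0%N /\ forall w, u < w -> w < u + e 0%N -> ~ K w)).
    move=> e'; split=> -[h [u g]]; split=> //; exists u; first by case: g.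
    by case: g => ? [? []].
  by solve_dset ltac:(apply: (dset1 hK); solve_dterm).
- by solve_dset ltac:(apply: (@dset_gap_end _ M (fun _ _ => K) (fun=> 0) (fun=> 0) _ _ hKK); solve_dterm).
- move=> d [d0 _]; apply: sub_finite_set (fin_diff _ d0) => l [[l0 [u g]] dl].
  exists (u, u + l); last by rewrite /= addrAC subrr add0r.
  by split; rewrite /=; [exists (u + l); left|exists u; right]; split=> //; lra.
- move=> d [d0 _]; apply: sub_finite_set (fin_diff _ d0) => z [x [gx gxz]].
  by exists (x, x + z) => //=; rewrite addrAC subrr add0r.
- move=> c d c0 cd de; pose z := (c + d) / 2.
  have [|x [Kx Kxz]] := he z; first by rewrite /z ger0_norm; lra.
  have r0 : 0 < (d - c) / 4 by lra.
  have xz : x != x + z by rewrite lt_eqF// /z; lra.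
  have [u [eta [eta0 /(lenL _ _ eta0)[l [Ll _ gu]]]]] := gap_end_near cK nK Kx Kxz xz r0.
  rewrite eq_sym in xz.
  have [v [eta' [eta'0 /(lenL _ _ eta'0)[l' [Ll' _ gv]]]]] := gap_end_near cK nK Kxz Kx xz r0.
  rewrite /z !ltr_norml => /andP[v1 v2] /andP[u1 u2].
  exists (v - u); split; first by apply/andP; split; lra.
  have uvu : u + (v - u) = v by rewrite addrC subrK.
  have [ll'|/ltW l'l] := leP l l'.
    by exists l => //; exists u; rewrite uvu; split=> //; exact: gap_end_mono gv.
  by exists l' => //; exists u; rewrite uvu; split=> //; exact: gap_end_mono gu.
Qed.

End LineCategory.

(** * Splitting off the first coordinate *)

Section Cons.
Context {R : realType}.

Definition vcons n (t : R) (y : 'rV[R]_n) : 'rV[R]_n.+1 :=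
  \row_i oapp (y 0) t (unlift ord0 i).

Definition vtl n (v : 'rV[R]_n.+1) : 'rV[R]_n := \row_j v 0 (lift ord0 j).

Lemma vcons0 n t (y : 'rV[R]_n) : vcons t y 0 ord0 = t.
Proof. by rewrite mxE unlift_none. Qed.

Lemma vconsS n t (y : 'rV[R]_n) j : vcons t y 0 (lift ord0 j) = y 0 j.
Proof. by rewrite mxE liftK. Qed.

Lemma vtl_cons n t (y : 'rV[R]_n) : vtl (vcons t y) = y.
Proof. by apply/rowP => j; rewrite mxE vconsS. Qed.

Lemma vcons_eta n (v : 'rV[R]_n.+1) : vcons (v 0 ord0) (vtl v) = v.
Proof.
by apply/rowP => i; case: (unliftP ord0 i) => [j|] ->; rewrite ?vconsS ?vcons0 ?mxE.
Qed.

Lemma forall_ordS n (P : 'I_n.+1 -> Prop) :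
  P ord0 -> (forall j, P (lift ord0 j)) -> forall i, P i.
Proof. by move=> P0 PS i; case: (unliftP ord0 i) => [j|] ->. Qed.

Lemma nonexpansive_continuous (T U : pseudoMetricType R) (f : T -> U) :
  (forall x y e, 0 < e -> ball x e y -> ball (f x) e (f y)) -> continuous f.
Proof.
move=> hf x V /nbhs_ballP[e /= e0 eV]; apply/nbhs_ballP.
by exists e => // y xy; apply: eV; exact: hf.
Qed.

Lemma vtl_continuous n : continuous (@vtl n).
Proof.
apply: nonexpansive_continuous => x y e e0 [_ xy].
by split=> // i j; rewrite !mxE; exact: xy.
Qed.

Lemma vcons_continuousr n t : continuous (@vcons n t).
Proof.
apply: nonexpansive_continuous => x y e e0 [_ xy].
by split=> // i; rewrite ord1; apply: forall_ordS => [|j];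
  rewrite ?vcons0 ?vconsS; [exact: ballxx|exact: xy].
Qed.

Lemma vcons_continuousl n (y : 'rV[R]_n) : continuous (fun t => vcons t y).
Proof.
apply: nonexpansive_continuous => t u e e0 xy.
by split=> // i; rewrite ord1; apply: forall_ordS => [|j];
  rewrite ?vcons0 ?vconsS; [exact: xy|exact: ballxx].
Qed.

Lemma rV_compact_closed n (A : set 'rV[R]_n) : compact A -> closed A.
Proof. by apply: compact_closed; exact: norm_hausdorff. Qed.

Lemma R_compact_closed (A : set R) : compact A -> closed A.
Proof. by apply: compact_closed; exact: norm_hausdorff. Qed.

Lemma compact_image n (f : 'rV[R]_n -> R) (A : set 'rV[R]_n) :
  continuous f -> compact A -> compact (f @` A).
Proof. by move=> cf; apply: continuous_compact; exact: continuous_subspaceT. Qed.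

Lemma compact_fiber n (A : set 'rV[R]_n.+1) t : compact A ->
  compact [set y | A (vcons t y)].
Proof.
move=> cA; apply: (@subclosed_compact _ _ (@vtl n @` A)).
- by apply: closed_comp (rV_compact_closed cA) => v _; exact: vcons_continuousr.
- by apply: continuous_compact => //; apply: continuous_subspaceT; exact: vtl_continuous.
- by move=> y Ay; exists (vcons t y); rewrite ?vtl_cons.
Qed.

Lemma compact_in_box n (A : set 'rV[R]_n) : compact A ->
  exists p q : 'rV[R]_n, (forall i, p 0 i <= q 0 i) /\ A `<=` Defs.box p q.
Proof.
move=> cA; have [[v0 Av0]|A0] := pselect (A !=set0); last first.
  by exists 0, 0; split=> // v Av; case: A0; exists v.
have /choice[b hb] (i : 'I_n) : exists b : R * R, forall v, A v -> b.1 < v 0 i <= b.2.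
  have cAi : compact ((fun v : 'rV[R]_n => v 0 i) @` A).
    by apply: compact_image cA => v; exact: coord_continuous.
  have Ai0 : ((fun v : 'rV[R]_n => v 0 i) @` A) !=set0 by exists (v0 0 i), v0.
  have [l _ hl] := compact_has_min cAi Ai0.
  have [u _ hu] := compact_has_max cAi Ai0.
  exists (l - 1, u) => v Av /=; rewrite hu ?andbT; last by exists v.
  have : l <= v 0 i by apply: hl; exists v.
  lra.
exists (\row_i (b i).1), (\row_i (b i).2); split=> [i|v Av i].
  by rewrite !mxE; have /andP[/ltW h1 h2] := hb i _ Av0; exact: le_trans h1 h2.
by rewrite !mxE in_itv /=; exact: hb.
Qed.

End Cons.

(** * Lebesgue outer measure *)

Section OuterMeasure.
Context {R : realType}.
Local Notation mu := (@lebesgue_measure R).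
Local Notation outer := (@lebesgue_outer_measure R _).
Local Notation vol p q := (box_volume p q).

Lemma box_volume_ge0 n (p q : 'rV[R]_n) : (forall i, p 0 i <= q 0 i) -> 0 <= vol p q.
Proof. by move=> pq; apply: prodr_ge0 => i _; rewrite subr_ge0. Qed.

Lemma box_volumeS n (p q : 'rV[R]_n.+1) :
  vol p q = (q 0 ord0 - p 0 ord0) * vol (vtl p) (vtl q).
Proof.
rewrite /box_volume big_ord_recl; congr (_ * _).
by apply: eq_bigr => i _; rewrite !mxE.
Qed.

Lemma box_cons n (p q : 'rV[R]_n.+1) t y : p 0 ord0 < t <= q 0 ord0 ->
  Defs.box (vtl p) (vtl q) y -> Defs.box p q (vcons t y).
Proof.
move=> tpq ypq; apply: forall_ordS => [|j]; first by rewrite vcons0 in_itv.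
by rewrite vconsS; have := ypq j; rewrite !mxE.
Qed.

Lemma boxS n (p q v : 'rV[R]_n.+1) : Defs.box p q v ->
  p 0 ord0 < v 0 ord0 <= q 0 ord0 /\ Defs.box (vtl p) (vtl q) (vtl v).
Proof. by move=> h; split=> [|j]; [have := h ord0|rewrite !mxE; exact: h]. Qed.

Lemma outer_ge0 n (A : set 'rV[R]_n) : (0 <= outer A)%E.
Proof.
apply: le_ereal_inf_tmp => _ [D [p [q [pq _ ->]]]].
by apply: esum_ge0 => k _; rewrite lee_fin box_volume_ge0.
Qed.

(** Countable index types spare the reindexing of unions of covers by [nat]. *)
Lemma outer_le_cover n (A : set 'rV[R]_n) (I : countType) (D : set I)
    (p q : I -> 'rV[R]_n) : (forall k i, p k 0 i <= q k 0 i) ->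
  A `<=` \bigcup_(k in D) Defs.box (p k) (q k) ->
  (outer A <= \esum_(k in D) (vol (p k) (q k))%:E)%E.
Proof.
move=> pq AD; apply: ereal_inf_lbound.
pose ext (f : I -> 'rV[R]_n) m := if unpickle m is Some k then f k else 0.
have extE f k : ext f (pickle k) = f k by rewrite /ext pickleK.
exists (pickle @` D), (ext p), (ext q); split.
- by move=> m i; rewrite /ext; case: unpickle.
- by move=> x /AD[k Dk kx]; exists (pickle k); [exists k|rewrite !extE].
- rewrite (@reindex_esum _ _ _ D (pickle @` D) pickle).
    by apply: eq_esum => k _; rewrite !extE.
  split; [by move=> k Dk; exists k| |by []].
  by move=> k k' _ _; exact: (pcan_inj pickleK).
Qed.

Lemma le_outer n (A B : set 'rV[R]_n) : A `<=` B -> (outer A <= outer B)%E.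
Proof.
move=> AB; apply: ereal_inf_le_tmp => _ [D [p [q [pq BD ->]]]].
by exists D, p, q; split=> //; exact: subset_trans BD.
Qed.

Lemma outer_bigcup n (A : nat -> set 'rV[R]_n) :
  (outer (\bigcup_k A k) <= \sum_(k <oo) outer (A k))%E.
Proof.
have [[k Ak]|fin] := pselect (exists k, outer (A k) = +oo%E).
  by rewrite (nneseries_pinfty _ _ Ak) ?leey// => m _; exact: outer_ge0.
have {}fin k : outer (A k) \is a fin_num.
  rewrite ge0_fin_numE ?outer_ge0// ltey; apply/eqP => h; apply: fin; by exists k.
apply/lee_addgt0Pr => e e0.
have /choice[F hF] k : exists c : set nat * (nat -> 'rV[R]_n) * (nat -> 'rV[R]_n),
    [/\ forall m i, c.1.2 m 0 i <= c.2 m 0 i,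
      A k `<=` \bigcup_(m in c.1.1) Defs.box (c.1.2 m) (c.2 m) &
      (\esum_(m in c.1.1) (vol (c.1.2 m) (c.2 m))%:E <=
        outer (A k) + (e / (2 ^ k.+1)%:R)%:E)%E].
  have ek : 0 < e / (2 ^ k.+1)%:R by rewrite divr_gt0// ltr0n expn_gt0.
  have [_ [D [p [q [pq AD ->]]]] /ltW hlt] := lb_ereal_inf_adherent ek (fin k).
  by exists (D, p, q).
pose D k := (F k).1.1; pose p k := (F k).1.2; pose q k := (F k).2.
apply: (@le_trans _ _ (\esum_(j in [set: nat] `*`` D) (vol (p j.1 j.2) (q j.1 j.2))%:E)%E).
  apply: (@outer_le_cover _ _ (nat * nat)%type _ (fun j => p j.1 j.2) (fun j => q j.1 j.2)).
    by move=> [k m] i; have [h _ _] := hF k; exact: h.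
  by move=> x [k _ /((let: And3 _ h _ := hF k in h) x)[m Dm mx]]; exists (k, m).
rewrite -(@esum_esum _ _ _ _ _ (fun k m => (vol (p k m) (q k m))%:E)); last first.
  by move=> k m _ _; rewrite lee_fin box_volume_ge0// => i; have [h _ _] := hF k; exact: h.
rewrite -nneseries_esumT; last first.
  move=> k; apply: esum_ge0 => m _; rewrite lee_fin box_volume_ge0// => i.
  by have [h _ _] := hF k; exact: h.
apply: le_trans (epsilon_trick xpredT _ (ltW e0)); last by move=> k; exact: outer_ge0.
apply: lee_nneseries => [k _ _|k _]; last by have [] := hF k.
apply: esum_ge0 => m _; rewrite lee_fin box_volume_ge0// => i.
by have [h _ _] := hF k; exact: h.
Qed.

Lemma outer_set0 n : outer (set0 : set 'rV[R]_n) = 0%E.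
Proof.
apply/eqP; rewrite eq_le outer_ge0 andbT.
rewrite -[leRHS](@esum_set0 R nat (fun=> (vol (0 : 'rV[R]_n) 0)%:E)).
by apply: (@outer_le_cover _ _ nat set0 (fun=> 0) (fun=> 0)).
Qed.

Lemma outer_setU n (A B : set 'rV[R]_n) : (outer (A `|` B) <= outer A + outer B)%E.
Proof.
rewrite -bigcup2E; apply: le_trans (outer_bigcup _) _.
rewrite (nneseries_split 0 2); last by move=> k _; exact: outer_ge0.
rewrite eseries0 ?adde0; last by move=> [|[|k]]// _ _; exact: outer_set0.
by rewrite big_mkord !big_ord_recl big_ord0 /= adde0.
Qed.

Lemma null_sub n (A B : set 'rV[R]_n) : A `<=` B -> lebesgue_null B -> lebesgue_null A.
Proof.
by move=> /le_outer AB B0; apply/eqP; rewrite eq_le outer_ge0 andbT -B0.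
Qed.

Lemma null_bigcup n (A : nat -> set 'rV[R]_n) :
  (forall k, lebesgue_null (A k)) -> lebesgue_null (\bigcup_k A k).
Proof.
move=> A0; apply/eqP; rewrite eq_le outer_ge0 andbT.
by apply: le_trans (outer_bigcup _) _; rewrite eseries0// => k _ _; exact: A0.
Qed.

End OuterMeasure.

(** * Volumes of boxes and null fibres *)

Section Fubini.
Context {R : realType}.
Local Notation mu := (@lebesgue_measure R).
Local Notation outer := (@lebesgue_outer_measure R _).
Local Notation vol p q := (box_volume p q).

Lemma mu_itv (a b : R) : a <= b -> mu `]a, b] = (b - a)%:E.
Proof.
move=> ab; rewrite lebesgue_measure_itv /= lte_fin; case: ltP => //.
by move=> ba; have -> : b = a by [apply/eqP; rewrite eq_le ab ba]; rewrite subrr.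
Qed.

(** Integrating over the first coordinate the inequality that holds between the
    volumes of the slices. *)
Lemma box_volume_le_cover n (a b : 'rV[R]_n) (D : set nat) (p q : nat -> 'rV[R]_n) :
  (forall i, a 0 i <= b 0 i) -> (forall k i, p k 0 i <= q k 0 i) ->
  Defs.box a b `<=` \bigcup_(k in D) Defs.box (p k) (q k) ->
  ((vol a b)%:E <= \esum_(k in D) (vol (p k) (q k))%:E)%E.
Proof.
elim: n a b D p q => [|n ih] a b D p q ab pq hD.
  have [k Dk _] : (\bigcup_(k in D) Defs.box (p k) (q k)) a by apply: hD => -[].
  have v1 (x y : 'rV[R]_0) : vol x y = 1 by rewrite /box_volume big_ord0.
  apply: esum_ge; exists [set k]; first by split=> // m ->.
  by rewrite fsbig_set1 !v1.
pose g k (t : R) : \bar R := if k \in D then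
  (vol (vtl (p k)) (vtl (q k)) * \1_(`]p k 0 ord0, q k 0 ord0]) t)%:E else 0%E.
have vtl_ge0 k : 0 <= vol (vtl (p k)) (vtl (q k)).
  by apply: box_volume_ge0 => i; rewrite !mxE.
have g0 k t : (0 <= g k t)%E.
  by rewrite /g; case: ifP => // _; rewrite lee_fin mulr_ge0// indicE.
have slice t : a 0 ord0 < t <= b 0 ord0 ->
    ((vol (vtl a) (vtl b))%:E <= \sum_(k <oo) g k t)%E.
  move=> tab; pose Dt := D `&` [set k | p k 0 ord0 < t <= q k 0 ord0].
  apply: (@le_trans _ _ (\esum_(k in Dt) (vol (vtl (p k)) (vtl (q k)))%:E)%E).
    apply: ih => [i|k i|y yab]; rewrite ?mxE//.
    have [k Dk /boxS[]] := hD _ (box_cons tab yab).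
    by rewrite vcons0 vtl_cons => h1 h2; exists k.
  rewrite nneseries_esumT// esum_mkcond; apply: le_esum => k _.
  case: ifPn => //; rewrite inE => -[Dk /= tk].
  by rewrite /g mem_set// indicE mem_set ?mulr1//= in_itv.
pose J := [set` `]a 0 ord0, b 0 ord0]] : set R.
have mJ : measurable J by exact: measurable_itv.
have muJ : mu J = (b 0 ord0 - a 0 ord0)%:E by exact: mu_itv.
have mg k : measurable_fun J (g k).
  rewrite /g; case: (k \in D); last exact: measurable_cst.
  by apply/measurable_EFinP; apply: measurable_funM; [exact: measurable_cst|exact: measurable_indic].
have : (\int[mu]_(t in J) cst (vol (vtl a) (vtl b))%:E t <=
   \int[mu]_(t in J) \sum_(k <oo) g k t)%E.
  apply: ge0_le_integral => //.
  - by move=> t _; rewrite lee_fin box_volume_ge0// => i; rewrite !mxE.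
  - by have := @ge0_emeasurable_sum _ _ R J g xpredT; apply.
have -> : (\int[mu]_(t in J) cst (vol (vtl a) (vtl b))%:E t = (vol a b)%:E)%E.
  by rewrite (@integral_cst _ _ _ mu _ mJ) box_volumeS mulrC EFinM; congr *%E; exact: muJ.
rewrite integral_nneseries//.
move/le_trans; apply; rewrite [leRHS]esum_mkcond -nneseries_esumT; last first.
  by move=> k; case: ifP => // _; rewrite lee_fin box_volume_ge0.
apply: lee_nneseries => [k _ _|k _]; first exact: integral_ge0.
rewrite /g; case: (k \in D); last by rewrite integral0.
under eq_integral do rewrite EFinM.
rewrite ge0_integralZl_EFin//.
- rewrite integral_indic// box_volumeS EFinM muleC; apply: lee_wpmul2r.
    by rewrite lee_fin.
  rewrite -mu_itv//; apply: le_measure; rewrite ?inE//; exact: measurableI.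
- by apply/measurable_EFinP; exact: measurable_indic.
Qed.

Lemma outer_box n (a b : 'rV[R]_n) : (forall i, a 0 i <= b 0 i) ->
  outer (Defs.box a b) = (vol a b)%:E.
Proof.
move=> ab; apply/eqP; rewrite eq_le; apply/andP; split.
  rewrite -[leRHS](@esum_set1 R nat 0%N (fun=> (vol a b)%:E)) ?lee_fin ?box_volume_ge0//.
  by apply: (@outer_le_cover _ _ _ nat [set 0%N] (fun=> a) (fun=> b)) => // x; exists 0%N.
apply: le_ereal_inf_tmp => _ [D [p [q [pq hD ->]]]].
exact: box_volume_le_cover.
Qed.

(** A property of intervals that is additive and holds for all short intervals
    around each point holds for all intervals: continue up to the supremum of the
    reachable points. *)
Lemma local_global (P : R -> R -> Prop) (a b : R) : a <= b ->
  (forall u w v, u <= w -> w <= v -> P u w -> P w v -> P u v) ->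
  (forall t, exists2 e, 0 < e & forall u v, t - e < u -> u <= v -> v < t + e -> P u v) ->
  P a b.
Proof.
move=> ab Padd Ploc.
pose S := [set x | a <= x <= b /\ P a x].
have Sa : S a.
  split; first by rewrite lexx ab.
  by have [e e0 h] := Ploc a; apply: h; lra.
have supS : has_sup S by split; [exists a|exists b => x [/andP[]]].
set s := sup S; have [e e0 hs] := Ploc s.
have as_ : a <= s by apply: (ub_le_sup supS.2).
have sb : s <= b by apply: ge_sup; [exists a|move=> x [/andP[]]].
have [x [/andP[ax xb] Px] sx] := sup_adherent e0 supS.
have xs : x <= s by apply: (ub_le_sup supS.2); split=> //; rewrite ax.
have [sb'|bs] := ltP (s + e / 2) b.
  have /(ub_le_sup supS.2) : S (s + e / 2).
    split; first by rewrite ltW//; lra.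
    by apply: (Padd _ x) => //; [lra|apply: hs => //; lra].
  by rewrite -/s; lra.
by apply: (Padd _ x) => //; apply: hs => //; lra.
Qed.

(** The volume is a polynomial in the enlargement [h], hence continuous at [0]. *)
Lemma vol_enlarge n (p q : 'rV[R]_n) (e : R) : 0 < e ->
  exists2 h, 0 < h & vol p (\row_i (q 0 i + h)) <= vol p q + e.
Proof.
move=> e0; pose P : {poly R} := \prod_i ('X + (q 0 i - p 0 i)%:P).
have PE h : P.[h] = vol p (\row_i (q 0 i + h)).
  rewrite horner_prod; apply: eq_bigr => i _; rewrite !hornerE mxE.
  by rewrite -[LHS]/(h + q 0 i - p 0 i) [h + _]addrC.
have P0 : P.[0] = vol p q by rewrite PE; apply: eq_bigr => i _; rewrite mxE addr0.
have /nbhs_ballP[d /= d0 hd] := @continuous_horner R P 0 _ (nbhsx_ballx P.[0] e e0).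
exists (d / 2); first by rewrite divr_gt0.
have : ball P.[0] e P.[d / 2].
  by apply: hd; rewrite /ball /= sub0r normrN ger0_norm; lra.
by rewrite /ball /= P0 PE ltr_norml; lra.
Qed.

Lemma open_box_open n (p q : 'rV[R]_n) : open [set x : 'rV[R]_n | forall i, p 0 i < x 0 i < q 0 i].
Proof.
rewrite openE => x xpq.
exists (fun _ i => `]p 0 i, q 0 i[%classic) => [i j|y hy i].
  by rewrite ord1; apply: near_in_itvoo; rewrite in_itv /=; exact: xpq.
by have := hy 0 i; rewrite /= in_itv.
Qed.

Lemma esumZl (D : set nat) (f : nat -> \bar R) (c : R) :
  0 <= c -> (forall k, 0 <= f k)%E ->
  (\esum_(k in D) (c%:E * f k) = c%:E * \esum_(k in D) f k)%E.
Proof.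
move=> c0 f0; have cf0 k : (0 <= c%:E * f k)%E by rewrite mule_ge0.
have h (g : nat -> \bar R) : (forall k, 0 <= g k)%E ->
    (\esum_(k in D) g k = \sum_(k <oo | k \in D) g k)%E.
  by move=> g0; rewrite nneseries_esum// set_mem_set.
by rewrite !h// nneseriesZl.
Qed.

(** Half-open boxes are turned into open ones by moving their upper corners, the
    [k]-th volume growing by at most [e / 2 / 2 ^ k.+1]. *)
Lemma null_open_cover n (A : set 'rV[R]_n) (e : R) : lebesgue_null A -> 0 < e ->
  exists (D : set nat) (p q : nat -> 'rV[R]_n) (W : set 'rV[R]_n),
  [/\ forall k i, p k 0 i <= q k 0 i, open W, A `<=` W,
     W `<=` \bigcup_(k in D) Defs.box (p k) (q k) &
     (\esum_(k in D) (vol (p k) (q k))%:E <= e%:E)%E].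
Proof.
move=> A0 e0; have e2 : 0 < e / 2 by rewrite divr_gt0.
have Afin : outer A \is a fin_num by rewrite A0.
have [_ [D [p [q [pq AD ->]]]]] := lb_ereal_inf_adherent e2 Afin.
rewrite -/(outer A) A0 add0e => /ltW hsum.
have d0 k : 0 < e / 2 / (2 ^ k.+1)%:R by rewrite divr_gt0// ltr0n expn_gt0.
have /choice[h hh] k : exists h : R, 0 < h /\
    vol (p k) (\row_i (q k 0 i + h)) <= vol (p k) (q k) + e / 2 / (2 ^ k.+1)%:R.
  have [h h0 hv] := @vol_enlarge n (p k) (q k) _ (d0 k).
  by exists h.
pose q' k := \row_i (q k 0 i + h k).
exists D, p, q', (\bigcup_(k in D) [set x | forall i, p k 0 i < x 0 i < q' k 0 i]); split.
- by move=> k i; rewrite mxE; have [h0 _] := hh k; apply: le_trans (pq k i) _; rewrite lerDl ltW.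
- by apply: bigcup_open => k _; exact: open_box_open.
- move=> x /AD[k Dk xk]; exists k => // i; have := xk i; rewrite in_itv /= mxE.
  by have [h0 _] := hh k; move=> /andP[-> xq]; rewrite (le_lt_trans xq)// ltrDl.
- move=> x [k Dk xk]; exists k => // i; have /andP[h1 h2] := xk i.
  by rewrite in_itv /= h1 ltW.
- apply: (@le_trans _ _ (\esum_(k in D) ((vol (p k) (q k))%:E + (e / 2 / (2 ^ k.+1)%:R)%:E))%E).
    by apply: le_esum => k _; rewrite -EFinD lee_fin; have [] := hh k.
  rewrite esumD; first last.
  - by move=> k _; rewrite lee_fin ltW.
  - by move=> k _; rewrite lee_fin box_volume_ge0.
  have -> : (e%:E = (e / 2)%:E + (e / 2)%:E)%E by rewrite -EFinD -splitr.
  apply: leeD => //.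
  apply: (@le_trans _ _ (\esum_(k in [set: nat]) (e / 2 / (2 ^ k.+1)%:R)%:E)%E).
    rewrite [leLHS]esum_mkcond; apply: le_esum => k _; case: ifP => _; first exact: lexx.
    by rewrite lee_fin ltW.
  rewrite -nneseries_esumT; last by move=> k; rewrite lee_fin ltW.
  exact: (epsilon_trick0 xpredT (ltW e2)).
Qed.

(** Above a short interval [u < t <= v] of first coordinates, [A] is covered by boxes
    of total volume [e * (v - u)] near a value with null fibre, and by a single
    box near the other values, which lie in an open set [U] of small measure. *)
Lemma null_fubini n (A : set 'rV[R]_n.+1) (N : set R) : compact A ->
  measurable N -> mu N = 0%E ->
  (forall t, ~ N t -> lebesgue_null [set y | A (vcons t y)]) -> lebesgue_null A.
Proof.
move=> cA mN N0 hfib; have [p [q [pq Apq]]] := compact_in_box cA.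
pose kap := vol (vtl p) (vtl q).
have kap0 : 0 <= kap by apply: box_volume_ge0 => i; rewrite !mxE.
have p0q0 : 0 <= q 0 ord0 - p 0 ord0 by rewrite subr_ge0.
pose C := (q 0 ord0 - p 0 ord0) + kap.
suff h e : 0 < e -> (outer A <= (e * C)%:E)%E.
  apply/eqP; rewrite eq_le outer_ge0 andbT; apply/lee_addgt0Pr => e e0.
  have C1 : 0 < C + 1 by rewrite /C; lra.
  apply: le_trans (h (e / (C + 1)) (divr_gt0 e0 C1)) _; rewrite add0e lee_fin.
  by rewrite mulrAC ler_pdivrMr// ler_pM2l//; lra.
move=> e0.
have [U [oU NU muU]] : exists U, [/\ open U, N `<=` U & (mu U <= e%:E)%E].
  have [|U [oU NU /ltW hU]] := lebesgue_regularity_outer mN _ e0.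
    by rewrite [X in (X < _)%E]N0 ltry.
  exists U; split=> //; rewrite -(setDKU NU).
  apply: le_trans (measureU2 _ _ _) _ => //; first by apply: measurableD => //; exact: open_measurable.
  by rewrite -[leRHS]adde0; apply: leeD; rewrite // le_eqVlt; apply/orP; left; apply/eqP.
have mU : measurable U by exact: open_measurable.
pose slab u v := A `&` [set x | u < x 0 ord0 <= v].
pose P (u v : R) := (outer (slab u v) <= (e * (v - u))%:E + kap%:E * mu (U `&` `]u, v]))%E.
have : P (p 0 ord0) (q 0 ord0).
  apply: (@local_global P); first exact: pq.
  - move=> u w v uw wv; rewrite /P => Puw Pwv.
    have muE : mu (U `&` `]u, v]) = (mu (U `&` `]u, w]) + mu (U `&` `]w, v]))%E.
      rewrite -measureU; [|exact: measurableI|exact: measurableI|].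
        by rewrite -setIUr; congr (mu (_ `&` _)); rewrite -itv_bndbnd_setU.
      apply/seteqP; split=> // x [[_ /=]]; rewrite in_itv /= => /andP[_ xw] [_ /=].
      by rewrite in_itv /= => /andP[wx _]; move: wx; rewrite ltNge xw.
    have slabE : slab u v `<=` slab u w `|` slab w v.
      move=> x [Ax /= /andP[ux xv]]; have [xw|wx] := leP (x 0 ord0) w.
        by left; split=> //=; rewrite ux.
      by right; split=> //=; rewrite wx.
    apply: le_trans (le_outer slabE) _; apply: le_trans (outer_setU _ _) _.
    apply: le_trans (leeD Puw Pwv) _.
    rewrite muE ge0_muleDr// addeACA -EFinD -mulrDr.
    by have -> : w - u + (v - w) = v - u by lra.
  move=> t; have [Ut|nUt] := pselect (U t).
    have /nbhs_ballP[d /= d0 dU] : nbhs t U by apply: open_nbhs_nbhs.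
    exists d => // u v tu uv vt; rewrite /P.
    have UE : U `&` `]u, v] = `]u, v]%classic.
      apply/setIidPr => x /=; rewrite in_itv /= => /andP[ux xv].
      by apply: dU; rewrite /ball /= ltr_norml; lra.
    rewrite UE; have -> : mu `]u, v] = (v - u)%:E by exact: mu_itv.
    pose p' := vcons u (vtl p); pose q' := vcons v (vtl q).
    apply: (@le_trans _ _ (outer (Defs.box p' q'))).
      apply: le_outer => x [/Apq/boxS[_ xpq] /= uxv].
      by rewrite -(vcons_eta x); apply: box_cons; rewrite /p' /q' ?vcons0 ?vtl_cons.
    rewrite outer_box; last first.
      by apply: forall_ordS => [|j]; rewrite ?vcons0// !vconsS !mxE.
    rewrite box_volumeS !vcons0 !vtl_cons -EFinM -EFinD lee_fin -/kap mulrC lerDr.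
    by rewrite mulr_ge0 ?subr_ge0// ltW.
  have At0 := hfib t (fun Nt => nUt (NU _ Nt)).
  have [D [r [s [W [rs oW AW WD hsum]]]]] := null_open_cover At0 e0.
  (* The values [t'] with fibre not inside [W] form a compact set missing [t]. *)
  pose B := A `&` [set x | ~ W (vtl x)].
  have cB : compact B.
    apply: compact_closedI => //.
    by apply: (@closed_comp _ _ (@vtl R n) (~` W)) => [x _|]; [exact: vtl_continuous|exact: open_closedC].
  pose hd (x : 'rV[R]_n.+1) := x 0 ord0.
  have oB : open (~` (hd @` B)).
    apply: closed_openC; apply: R_compact_closed; apply: compact_image cB.
    by move=> x; exact: coord_continuous.
  have /nbhs_ballP[d /= d0 hd'] : nbhs t (~` (hd @` B)).
    apply: open_nbhs_nbhs; split=> // -[x [Ax nW] xt]; apply: nW; apply: AW => /=.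
    by rewrite -xt vcons_eta.
  exists d => // u v tu uv vt; rewrite /P.
  apply: (@le_trans _ _ (e * (v - u))%:E); last by rewrite leeDl// mule_ge0.
  apply: (@le_trans _ _ (\esum_(k in D) (vol (vcons u (r k)) (vcons v (s k)))%:E)%E).
    apply: (@outer_le_cover _ _ _ nat) => [k|x [Ax /= uxv]].
      by apply: forall_ordS => [|j]; rewrite ?vcons0// !vconsS.
    have [|k Dk xk] := WD (vtl x).
      apply: contrapT => nW; apply: (hd' (x 0 ord0)); last by exists x.
      by rewrite /ball /= ltr_norml; move: uxv => /andP[? ?]; lra.
    exists k => //; rewrite -(vcons_eta x).
    by apply: box_cons; rewrite ?vcons0 ?vtl_cons.
  under eq_esum do rewrite box_volumeS !vcons0 !vtl_cons EFinM.
  rewrite esumZl ?subr_ge0//; last by move=> k; rewrite lee_fin box_volume_ge0.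
  by rewrite mulrC EFinM; apply: lee_wpmul2l; rewrite ?lee_fin ?subr_ge0.
move=> h; apply: (@le_trans _ _ (outer (slab (p 0 ord0) (q 0 ord0)))).
  by apply: le_outer => x Ax; split=> //=; have := Apq _ Ax ord0; rewrite in_itv.
apply: le_trans h _.
have -> : e * C = e * (q 0 ord0 - p 0 ord0) + kap * e by rewrite /C mulrDr [e * kap]mulrC.
rewrite EFinD; apply: leeD => //.
rewrite EFinM; apply: lee_wpmul2l; first by rewrite lee_fin.
by apply: le_trans muU; apply: le_measure; rewrite ?inE//; exact: measurableI.
Qed.

End Fubini.

(** * Cubes *)

Section Cubes.
Context {R : realType}.

Definition cube n (p : 'rV[R]_n) (h : R) : set 'rV[R]_n :=
  [set y | forall i, p 0 i - h <= y 0 i <= p 0 i + h].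

(** The cubes with rational centre and radius [1 / k.+1]: countably many, and every
    cube contains one. *)
Definition rat_cube n (c : 'rV[rat]_n * nat) : set 'rV[R]_n :=
  cube (map_mx ratr c.1) (c.2.+1%:R^-1).

Lemma cube_center n (p : 'rV[R]_n) h : 0 <= h -> cube p h p.
Proof. by move=> h0 i; apply/andP; split; lra. Qed.

Lemma cube_sub_ball n (p : 'rV[R]_n) h e : 0 < e -> h < e -> cube p h `<=` ball p e.
Proof.
move=> e0 he y py; split=> // i j; rewrite ord1 /ball /= ltr_norml.
by have /andP[h1 h2] := py j; lra.
Qed.

Lemma ball_sub_cube n (p : 'rV[R]_n) h : ball p h `<=` cube p h.
Proof.
move=> y [h0 py] i; have := py 0 i; rewrite /ball /= ltr_norml; lra.
Qed.

Lemma le_cube n (p : 'rV[R]_n) h h' : h <= h' -> cube p h `<=` cube p h'.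
Proof. by move=> hh' y py i; have /andP[? ?] := py i; apply/andP; split; lra. Qed.

Lemma cube_cons n (p : 'rV[R]_n.+1) h t y :
  cube p h (vcons t y) <-> p 0 ord0 - h <= t <= p 0 ord0 + h /\ cube (vtl p) h y.
Proof.
split=> [hc|[ht hy]].
  split=> [|j]; first by have := hc ord0; rewrite vcons0.
  by have := hc (lift ord0 j); rewrite vconsS !mxE.
by apply: forall_ordS => [|j]; rewrite ?vcons0// vconsS; have := hy j; rewrite !mxE.
Qed.

Lemma cube_compact n (p : 'rV[R]_n) h : compact (cube p h).
Proof.
have := @rV_compact R n (fun i => `[p 0 i - h, p 0 i + h]%classic)
  (fun i => @segment_compact _ _ _).
by congr compact; apply/seteqP; split=> y hy i; have := hy i; rewrite /= in_itv.
Qed.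

Lemma small_invr (e : R) : 0 < e -> exists k, k.+1%:R^-1 <= e.
Proof.
move=> e0; exists (Num.truncn e^-1); rewrite -[leRHS]invrK lef_pV2 ?posrE ?invr_gt0//.
by have /andP[_ /ltW] : (Num.truncn e^-1)%:R <= e^-1 < (Num.truncn e^-1).+1%:R
  by apply: truncn_itv; rewrite invr_ge0 ltW.
Qed.

Lemma rat_cube_sub n (p : 'rV[R]_n) h : 0 < h ->
  exists c : 'rV[rat]_n * nat, rat_cube c `<=` cube p h.
Proof.
move=> h0; have /choice[q hq] (i : 'I_n) : exists q : rat,
    p 0 i - h / 2 < ratr q < p 0 i + h / 2.
  have [|q] := @rat_in_itvoo R (p 0 i - h / 2) (p 0 i + h / 2); first lra.
  by rewrite in_itv; exists q.
have [k hk] : exists k, k.+1%:R^-1 <= h / 2 by apply: small_invr; rewrite divr_gt0.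
exists (\row_i q i, k) => y hy i; have := hy i; rewrite /= !mxE.
have /andP[? ?] := hq i; move: hk; set r := _^-1 => hk /andP[? ?].
by apply/andP; split; lra.
Qed.

(** By the Baire category theorem, the complements of the traces of the [F i] on
    [a, b] are not all dense. *)
Lemma baire_interval (I : countType) (F : I -> set R) (a b : R) : a < b ->
  (forall i, closed (F i)) -> (forall x, a < x < b -> exists i, F i x) ->
  exists i c d, [/\ c < d, a <= c, d <= b & forall x, c < x < d -> F i x].
Proof.
move=> ab cF covF.
pose G m := ~` (if unpickle m is Some i then F i `&` `[a, b] else set0).
have oG m : open (G m).
  apply: closed_openC; case: unpickle => [i|]; last exact: closed0.
  by apply: closedI => //; exact: itv_closed.
have [dG|] := pselect (forall m, dense (G m)).
  have /(_ `]a, b[%classic) := @Baire R R G (fun m => conj (oG m) (dG m)).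
  case; [by exists ((a + b) / 2); rewrite /= in_itv /=; lra|exact: itv_open|].
  move=> x [/= xab hG]; have xab' := xab; rewrite in_itv /= in xab'.
  have [i Fix] := covF _ xab'; have := hG (pickle i) Logic.I; rewrite /G pickleK; case.
  by split=> //; apply: subset_itv_oo_cc.
move=> /existsNP[m /existsNP[ O]] /not_implyP[] [x Ox] /not_implyP[oO hO].
have OG y : O y -> ~ G m y by move=> Oy Gy; apply: hO; exists y.
have [z Oz] : exists z : R, O z by exists x.
have /nbhs_ballP[d /= d0 dO] : nbhs z O by exact: open_nbhs_nbhs.
have inO (y : R) : `|z - y| < d -> exists2 i, unpickle m = Some i & F i y /\ a <= y <= b.
  move=> /dO /OG; rewrite /G; case: unpickle => [i|] /contrapT // [Fy /=].
  by rewrite in_itv /= => yab; exists i.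
have [|i mi _] := inO z; first by rewrite subrr normr0.
exists i, (z - d / 2), (z + d / 2); split; first lra.
- have [|_ _ [_ /andP[//]]] := inO (z - d / 2); first by rewrite ltr_norml; lra.
- have [|_ _ [_ /andP[//]]] := inO (z + d / 2); first by rewrite ltr_norml; lra.
- move=> y /andP[? ?]; have [|j] := inO y; first by rewrite ltr_norml; lra.
  by rewrite mi => -[->] [].
Qed.

Lemma closed_fiber_contains n (A : set 'rV[R]_n.+1) (B : set 'rV[R]_n) : closed A ->
  closed [set t | B `<=` [set y | A (vcons t y)]].
Proof.
move=> cA; have -> : [set t | B `<=` [set y | A (vcons t y)]] =
    \bigcap_(y in B) [set t | A (vcons t y)] by apply/seteqP; split.
apply: closed_bigI => y _.
by apply: (@closed_comp _ _ (fun t => vcons t y) A) => // t _; exact: vcons_continuousl.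
Qed.

Lemma cube_of_fibers n (A : set 'rV[R]_n.+1) (B : set 'rV[R]_n) p h u v :
  0 < h -> u < v -> cube p h `<=` B ->
  (forall t, u < t < v -> B `<=` [set y | A (vcons t y)]) ->
  exists q k, 0 < k /\ cube q k `<=` A.
Proof.
move=> h0 uv pB hA; exists (vcons ((u + v) / 2) p), (Num.min h ((v - u) / 4)).
rewrite lt_min h0; split=> [|x]; first lra.
rewrite -(vcons_eta x) cube_cons vcons0 vtl_cons => -[/andP[t1 t2] /le_cube hx].
have h1 : Num.min h ((v - u) / 4) <= (v - u) / 4 by rewrite ge_min lexx orbT.
by apply: hA; [apply/andP; split; lra|apply/pB/hx; rewrite ge_min lexx].
Qed.

End Cubes.

(** * The theorems in several variables *)

Section Space.
Context {R : realType}.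
Variable M : expansion R.
Hypothesis hM : ~ defines_dense_omega_orderable M.

Record dsigma n (X : R -> R -> set 'rV[R]_n) : Prop := DSigma {
  dsigma_dset : dset M (fun e => X (e 0%N) (e 1%N) (vec n (fun k => e k.+2)));
  dsigma_compact : forall r s, compact (X r s);
  dsigma_mono : forall r r' s s', 0 < s' -> r <= r' -> s' <= s -> X r s `<=` X r' s';
  dsigma_gt0 : forall r s x, X r s x -> 0 < r /\ 0 < s }.

Lemma dsigma_diagonal n X r s : @dsigma n X -> 0 < r -> 0 < s ->
  exists k, X r s `<=` X k.+1%:R k.+1%:R^-1.
Proof.
move=> [_ _ mX _] r0 s0; have [m hm] := small_invr s0.
exists (maxn m (Num.truncn r)); apply: mX; first by rewrite invr_gt0.
  have /andP[_ /ltW rt] : (Num.truncn r)%:R <= r < (Num.truncn r).+1%:R.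
    by apply: truncn_itv; exact: ltW.
  by apply: le_trans rt _; rewrite ler_nat ltnS leq_maxr.
by apply: le_trans hm; rewrite lef_pV2 ?posrE// ler_nat ltnS leq_maxl.
Qed.

Lemma dset_dsigma n X t u (w : nat -> (nat -> R) -> R) : @dsigma n X ->
  dterm M t -> dterm M u -> (forall k, dterm M (w k)) ->
  dset M (fun e => X (t e) (u e) (vec n (fun k => w k e))).
Proof.
move=> dX ht hu hw.
apply: (@dset_subst _ M _ (fun k => match k with 0%N => t | 1%N => u | k'.+2 => w k' end)
   _ (dsigma_dset dX)) => -[|[|k]] //.
Qed.

Lemma vcons_vec n t (e : nat -> R) : vcons t (vec n e) = vec n.+1 (env_cons t e).
Proof. by apply/rowP; apply: forall_ordS => [|j]; rewrite ?vcons0 ?vconsS !mxE. Qed.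

Lemma dset_all_vec n (P : (nat -> R) -> 'rV[R]_n -> Prop) :
  dset M (fun e => P (fun k => e (n + k)%N) (vec n e)) -> dset M (fun e => forall x, P e x).
Proof.
move=> h; apply: (@dset_ext _ _ _ (fun e => ~ exists x, ~ P e x)).
  by move=> e; rewrite -forallNE; split=> hP a; [apply|apply: contrapT (hP a)].
exact/dset_not/dset_ex_vec/dset_not.
Qed.

Lemma dset_cube n p h : dset M (fun e => cube p h (vec n e)).
Proof.
apply: dset_forall_fin => i.
apply: (@dset_ext _ _ _ (fun e => p 0 i - h <= e i /\ e i <= p 0 i + h)).
  by move=> e; rewrite mxE; split=> [/andP|[? ?]] //; apply/andP.
by solve_dset idtac.
Qed.

Lemma dsigma_fiber n X t : @dsigma n.+1 X ->
  @dsigma n (fun r s => [set y | X r s (vcons t y)]).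
Proof.
move=> dX; have [_ cX mX pX] := dX; split.
- apply: (@dset_ext _ _ _ (fun e => X (e 0%N) (e 1%N)
    (vec n.+1 (fun k => if k is k'.+1 then e k'.+2 else t)))).
    by move=> e /=; rewrite vcons_vec.
  apply: (dset_dsigma dX); [exact: dterm_var|exact: dterm_var|].
  by case=> [|k]; [exact: dterm_const|exact: dterm_var].
- by move=> r s; exact: compact_fiber.
- by move=> r r' s s' h1 h2 h3 y; exact: mX.
- by move=> r s y /pX.
Qed.

(** The part of [X r s] above a cube has a compact projection; the quantifier over
    its fibre is first-order. *)
Lemma dsigma_proj n X p h : @dsigma n.+1 X ->
  dsigma1 M (fun r s => [set t | exists y, cube p h y /\ X r s (vcons t y)]).
Proof.
move=> dX; have [_ cX mX pX] := dX; split.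
- apply: dset_ex_vec; apply: dset_and; first exact: dset_cube.
  apply: (@dset_ext _ _ _ (fun e => X (e (n + 0)%N) (e (n + 1)%N)
    (vec n.+1 (fun k => if k is k'.+1 then e k' else e (n + 2)%N)))).
    by move=> e /=; rewrite vcons_vec.
  apply: (dset_dsigma dX); [exact: dterm_var|exact: dterm_var|].
  by case=> [|k]; exact: dterm_var.
- move=> r s; pose hd (x : 'rV[R]_n.+1) := x 0 ord0.
  have -> : [set t | exists y, cube p h y /\ X r s (vcons t y)] =
      hd @` (X r s `&` [set x | cube p h (vtl x)]).
    apply/seteqP; split=> [t [y [py Xy]]|_ [x [Xx px] <-]].
      by exists (vcons t y); [split=> //=; rewrite vtl_cons|rewrite /hd vcons0].
    by exists (vtl x); split=> //; rewrite /hd vcons_eta.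
  apply: compact_image; first by move=> x; exact: coord_continuous.
  apply: compact_closedI; first exact: cX.
  apply: (@closed_comp _ _ (@vtl R n) (cube p h)) => [x _|]; first exact: vtl_continuous.
  by apply: rV_compact_closed; exact: cube_compact.
- by move=> r r' s s' h1 h2 h3 t [y [py Xy]]; exists y; split=> //; exact: mX Xy.
- by move=> r s t [y [_ /pX]].
Qed.

(** Project onto the first coordinate. By the case of the line, for generic [t]
    the fibre over [t] meets every rational cube of the tail of [cube p h], so
    that the induction hypothesis applies to it and yields a rational cube. *)
Theorem baire_category n (X : R -> R -> set 'rV[R]_n) p h : dsigma X -> 0 < h ->
  (forall q k, 0 < k -> cube q k `<=` cube p h -> exists r s y, cube q k y /\ X r s y) ->
  exists r s q k, 0 < k /\ cube q k `<=` X r s.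
Proof.
elim: n X p h => [|n ih] X p h dX h0 dense.
  have [r [s [y [_ Xy]]]] := dense p h h0 (@subset_refl _ _).
  exists r, s, y, 1; split=> // z _; have -> // : z = y.
  by apply/rowP => -[].
have [_ cX mX pX] := dX.
pose cubes : countType := ('rV[rat]_n * nat)%type.
pose proj (c : cubes) r s := [set t | exists y, rat_cube c y /\ X r s (vcons t y)].
have dproj c : dsigma1 M (proj c) by exact: dsigma_proj.
pose O (c : cubes) := [set t | exists u v r s,
  u < t < v /\ forall x, u < x < v -> proj c r s x].
have oO c : open (O c).
  rewrite openE => t [u [v [r [s [utv hp]]]]].
  have : t \in `]u, v[ by rewrite in_itv.
  by move=> /near_in_itvoo; apply: filterS => x; rewrite in_itv => uxv; exists u, v, r, s.
(* If [rat_cube c] lies in the tail of [cube p h], the complement of [O c] is nowhere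
   dense by the case of the line; the sets [F (inr _)] cover the values that lie in
   all these [O c]. *)
pose F (i : cubes + cubes * nat) : set R := match i with
  | inl c => if pselect (rat_cube c `<=` cube (vtl p) h) then ~` O c else set0
  | inr (c, k) => [set t | rat_cube c `<=` [set y | X k.+1%:R (k.+1%:R^-1) (vcons t y)]]
  end.
have cF i : closed (F i).
  case: i => [c|[c k]] /=; last first.
    by apply: closed_fiber_contains; apply: rV_compact_closed; exact: cX.
  by case: pselect => hc /=; [exact: open_closedC|exact: closed0].
have cov t : p 0 ord0 - h < t < p 0 ord0 + h -> exists i, F i t.
  move=> tp; apply: contrapT => nF.
  have hO c : rat_cube c `<=` cube (vtl p) h -> O c t.
    move=> hc; apply: contrapT => nO; apply: nF; exists (inl c) => /=.
    by case: pselect.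
  have [q k k0 qk|r [s [q [k [k0 hq]]]]] := ih _ (vtl p) h (dsigma_fiber t dX) h0.
    have [c hc] := rat_cube_sub q k0.
    have [u [v [r [s [utv hp]]]]] := hO c (subset_trans hc qk).
    have [y [cy Xy]] := hp _ utv.
    by exists r, s, y; split=> //; exact: hc.
  have [r0 s0] : 0 < r /\ 0 < s := pX _ _ _ (hq _ (cube_center _ (ltW k0))).
  have [c hc] := rat_cube_sub q k0.
  have [m hm] := dsigma_diagonal dX r0 s0.
  by apply: nF; exists (inr (c, m)) => y /hc /hq /hm.
have [|[c|[c k]] [u [v [uv pu vp hF]]]] := baire_interval _ cF cov; first lra.
  exfalso; move: hF; rewrite /F; case: pselect => [hc|nc] /= hF; last first.
    by apply: (hF ((u + v) / 2)); apply/andP; split; lra.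
  have [|r [s [c1 [d1 [cd uc dv hX]]]]] := baire_category_line hM (dproj c) uv.
    move=> c1 d1 uc cd dv.
    pose rad := Num.min ((d1 - c1) / 4) (c.2.+1%:R^-1) : R.
    have rad1 : rad <= (d1 - c1) / 4 by rewrite ge_min lexx.
    have rad2 : rad <= c.2.+1%:R^-1 by rewrite ge_min lexx orbT.
    have rad0 : 0 < rad by rewrite lt_min invr_gt0 ltr0Sn andbT; lra.
    pose q := vcons ((c1 + d1) / 2) (map_mx ratr c.1) : 'rV[R]_n.+1.
    have qc y t : cube q rad (vcons t y) -> c1 < t < d1 /\ rat_cube c y.
      rewrite cube_cons vcons0 vtl_cons => -[/andP[t1 t2] /(le_cube rad2) hy].
      by split=> //; apply/andP; split; lra.
    have [x|r [s [y]]] := dense q rad rad0.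
      rewrite -(vcons_eta x) => /qc[/andP[x1 x2] /hc hx]; rewrite cube_cons.
      by split=> //; apply/andP; split; lra.
    rewrite -(vcons_eta y) => -[/qc[ycd cy] Xy].
    by exists r, s, (y 0 ord0); split=> //; exists (vtl y).
  apply: (hF ((c1 + d1) / 2)); first by apply/andP; split; lra.
  exists c1, d1, r, s; split=> [|x /andP[x1 x2]]; first by apply/andP; split; lra.
  by apply: hX; rewrite !ltW.
have [|q [m [m0 hq]]] := @cube_of_fibers _ _ (X k.+1%:R k.+1%:R^-1) (rat_cube c)
  (map_mx ratr c.1) (c.2.+1%:R^-1) u v _ uv (@subset_refl _ _) hF.
  by rewrite invr_gt0.
by exists k.+1%:R, k.+1%:R^-1, q, m.
Qed.

(** By [null_fubini], since the fibres without cubes are null by induction and,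
    for each [h], the values [t] above which [A] contains a cube of size [h] form a
    compact definable set, without interior by [baire_interval]. *)
Theorem compact_null n (A : set 'rV[R]_n) : dset M (fun e => A (vec n e)) -> compact A ->
  (forall p h, 0 < h -> ~ cube p h `<=` A) -> lebesgue_null A.
Proof.
elim: n A => [|n ih] A dA cA nA.
  have -> : A = set0; last exact: outer_set0.
  apply/seteqP; split=> // v Av; apply: (nA v 1 ltr01) => w _.
  by have -> // : w = v by apply/rowP => -[].
pose N (h : R) := [set t | exists x, forall d, cube 0 h d -> A (vcons t (x + d))].
have fibN t x h : (forall d, cube 0 h d -> A (vcons t (x + d))) ->
    cube x h `<=` [set y | A (vcons t y)].
  move=> hA y xy; have -> : y = x + (y - x) by rewrite addrC subrK.
  apply: hA => i; rewrite !mxE; have /andP[? ?] := xy i; apply/andP; split; lra.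
have dN h : dset M (fun e => N h (e 0%N)).
  apply: dset_ex_vec; apply: dset_all_vec; apply: dset_imp; first exact: dset_cube.
  pose w k (e : nat -> R) := if k is k'.+1 then e (n + k')%N + e k' else e (n + (n + 0))%N.
  apply: (@dset_ext _ _ _ (fun e => A (vec n.+1 (fun k => w k e)))).
    move=> e; suff -> : vcons (e (n + (n + 0))%N) (vec n (fun k => e (n + k)%N) + vec n e) =
        vec n.+1 (fun k => w k e) by [].
    by apply/rowP; apply: forall_ordS => [|j]; rewrite ?vcons0 ?vconsS !mxE.
  apply: (dset_subst (t := w)) dA => -[|k]; first exact: dterm_var.
  by apply: dterm_add; exact: dterm_var.
have cN h : 0 <= h -> compact (N h).
  move=> h0; pose hd (x : 'rV[R]_n.+1) := x 0 ord0.
  pose sh d (x : 'rV[R]_n.+1) := vcons (hd x) (vtl x + d).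
  have -> : N h = hd @` (A `&` \bigcap_(d in cube 0 h) (sh d @^-1` A)).
    apply/seteqP; split=> [t [x hx]|_ [x [_ hx] <-]].
      exists (vcons t x); last exact: vcons0.
      split; first by rewrite -[x]addr0; exact/hx/cube_center.
      by move=> d /hx; rewrite /sh /= /hd vcons0 vtl_cons.
    by exists (vtl x) => d /hx.
  apply: compact_image; first by move=> x; exact: coord_continuous.
  apply: compact_closedI => //; apply: closed_bigI => d _.
  apply: closed_comp (rV_compact_closed cA) => x _; apply: nonexpansive_continuous.
  move=> {}x y e e0 [_ xy]; split=> // i; rewrite ord1.
  apply: forall_ordS => [|j]; rewrite /sh ?vcons0 ?vconsS; first exact: xy.
  by rewrite !mxE /ball /= opprD addrACA subrr addr0; exact: xy.
have N0 h : 0 < h -> lebesgue_measure (N h) = 0%E.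
  move=> h0; apply: (compact_null_line hM (dN h)); first exact/cN/ltW.
  move=> c d cd; apply: contrapT => hN.
  pose F (q : 'rV[rat]_n * nat) := [set t | rat_cube q `<=` [set y | A (vcons t y)]].
  have [q|t tcd|q [u [v [uv _ _ hF]]]] := @baire_interval _ _ F c d cd.
  - by apply: closed_fiber_contains; apply: rV_compact_closed.
  - have [x /fibN hx] : N h t by apply: contrapT => Nt; apply: hN; exists t.
    by have [q hq] := rat_cube_sub x h0; exists q; exact: subset_trans hx.
  - have q0 : 0 < q.2.+1%:R^-1 :> R by rewrite invr_gt0.
    have [p [k [k0 pk]]] := cube_of_fibers q0 uv (@subset_refl _ _) hF.
    exact: nA pk.
pose NN := \bigcup_k N k.+1%:R^-1.
have mN k : measurable (N k.+1%:R^-1).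
  by apply: compact_measurable; apply: cN; rewrite invr_ge0.
apply: (@null_fubini _ _ A NN) => //.
- exact: bigcup_measurable.
- apply: measure_negligible; first by apply: bigcup_measurable => k _; exact: mN.
  apply: negligible_bigcup => k; apply/negligibleP; first exact: mN.
  by apply: N0; rewrite invr_gt0.
move=> t nNt; apply: ih; [|exact: compact_fiber|].
- apply: (@dset_ext _ _ _ (fun e => A (vec n.+1 (fun k => if k is k'.+1 then e k' else t)))).
    by move=> e /=; rewrite vcons_vec.
  apply: (dset_subst (t := fun k e => if k is k'.+1 then e k' else t)) dA => -[|k].
    exact: dterm_const.
  exact: dterm_var.
- move=> p h h0 hp; apply: nNt; have [k hk] := small_invr h0.
  exists k => //; exists p => d hd; apply: hp => i; rewrite !mxE.
  by have := hd i; rewrite mxE; move: hk; set r := _^-1 => hk /andP[? ?]; apply/andP; split; lra.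
Qed.

Lemma D_Sigma_dsigma n (A : set 'rV[R]_n) : D_Sigma M A ->
  exists2 X, dsigma X & A = [set x | exists r s, X r s x].
Proof.
move=> [X [dX cX mX ->]].
exists (fun r s => [set x | [/\ 0 < r, 0 < s & X r s x]]) => //; split.
- have /definable_dset := dX; apply: dset_ext => e /=.
  rewrite !mxE /=; have -> // : rsubmx (vec (2 + n) e) = vec n (fun k => e k.+2).
  by apply/rowP => i; rewrite !mxE.
- move=> r s; have [r0|r0] := ltP 0 r; last first.
    rewrite (_ : [set x | _] = set0); first exact: compact0.
    by apply/seteqP; split=> // x []; lra.
  have [s0|s0] := ltP 0 s; last first.
    rewrite (_ : [set x | _] = set0); first exact: compact0.
    by apply/seteqP; split=> // x []; lra.
  rewrite (_ : [set x | _] = X r s); first exact: cX.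
  by apply/seteqP; split=> x // [].
- move=> r r' s s' s'0 rr' ss' x [r0 s0 Xx].
  have r'0 : 0 < r' by lra.
  by split=> //; exact: mX Xx.
- by move=> r s x [].
Qed.

Lemma cube_interior n (A : set 'rV[R]_n) p h : 0 < h -> cube p h `<=` A -> interior A p.
Proof. by move=> h0 pA; apply/nbhs_ballP; exists h => //= y /ball_sub_cube /pA. Qed.

Lemma interior_cube n (A : set 'rV[R]_n) p : interior A p ->
  exists2 h, 0 < h & cube p h `<=` A.
Proof.
move=> /nbhs_ballP[d /= d0 dA]; exists (d / 2); first by rewrite divr_gt0.
by apply: subset_trans dA; apply: cube_sub_ball => //; lra.
Qed.

End Space.

Theorem theoremD (R : realType) (M : expansion R) (n : nat) (A : set 'rV[R]_n)
    (hM : ~ defines_dense_omega_orderable M) (hA : D_Sigma M A) :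
  [<-> interior A = set0;
       nowhere_dense A;
       lebesgue_null A].
Proof.
have [X dX AE] := D_Sigma_dsigma hA; have [_ cX mX pX] := dX.
tfae.
- move=> A0; apply/seteqP; split=> // x /interior_cube[h h0 hx].
  have [q k k0 qk|r [s [q [k [k0 hq]]]]] := baire_category hM (p := x) dX h0.
    have [y [Ay qy]] : (A `&` ball q k) !=set0.
      by apply: hx; [exact/qk/cube_center/ltW|exact: nbhsx_ballx].
    move: Ay; rewrite {1}AE => -[r [s Xy]].
    by exists r, s, y; split=> //; exact: ball_sub_cube.
  have : interior A q.
    by apply: (cube_interior k0); rewrite AE => y /hq; exists r, s.
  by rewrite A0.
- move=> nd; have -> : A = \bigcup_k X k.+1%:R k.+1%:R^-1.
    rewrite AE; apply/seteqP; split=> [x [r [s Xx]]|x [k _ Xx]]; last by exists k.+1%:R, k.+1%:R^-1.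
    have [r0 s0] := pX _ _ _ Xx; have [m hm] := dsigma_diagonal dX r0 s0.
    by exists m => //; exact: hm.
  apply: null_bigcup => k; apply: (compact_null hM) => [||p h h0 hp].
  + by apply: (dset_dsigma dX) => *; [exact: dterm_const|exact: dterm_const|exact: dterm_var].
  + exact: cX.
  + have : interior (closure A) p.
      apply: (cube_interior h0) => y /hp Xy; apply: subset_closure.
      by rewrite AE; exists k.+1%:R, k.+1%:R^-1.
    by rewrite nd.
- move=> A0; apply/seteqP; split=> // x /interior_cube[h h0 hx].
  pose a := \row_i (x 0 i - h); pose b := \row_i (x 0 i + h).
  have ab i : a 0 i <= b 0 i by rewrite !mxE; lra.
  have boxA : Defs.box a b `<=` A.
    move=> y hy; apply: hx => i; have := hy i; rewrite in_itv /= !mxE => /andP[? ->].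
    by rewrite andbT ltW.
  have := null_sub boxA A0; rewrite /lebesgue_null outer_box// => -[] /eqP.
  rewrite /box_volume prodf_seq_eq0 => /hasP[i _ /=]; rewrite !mxE.
  by move=> /eqP; lra.
Qed.
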